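(* The edge generating series of the Grand Schröder lattices is $$\sum_{n\ge0}\ell(\mathcal{GS}_n)x^n=\frac{2(x-x^2)}{(1-6x+x^2)^{3/2}}.$$ Moreover, for every $n\ge0$, $$\ell(\mathcal{GS}_n)=2\sum_{k=0}^n\binom{n+k}{2k}\binom{2k}{k}(n-k)=\sum_{k=0}^{\lfloor n/2\rfloor}\binom nk\binom{n-k}{k}\frac{(n-2k)(n+k+2)}{k+1}\,2^{k+1}3^{n-2k-2}.$$ Finally, $\ell(\mathcal{GS}_n)\sim\sqrt{\frac{n}{2\sqrt2\,\pi}}\,(1+\sqrt2)^{2n}$ and $i(\mathcal{GS}_n)=\ell(\mathcal{GS}_n)/|\mathcal{GS}_n|\sim(2-\sqrt2)n$.
   Context: Steps: $U=(1,1)$, $D=(1,-1)$, $H=(2,0)$. $\mathcal{GS}_n$ is the set of all lattice paths from $(0,0)$ to $(2n,0)$ with steps $U,D,H$, partially ordered by $\gamma_1\le\gamma_2$ iff $\gamma_1$ lies weakly below $\gamma_2$. $\ell(P)$ is the number of edges (covering pairs) of the Hasse diagram of a finite poset $P$ and $i(P)=\ell(P)/|P|$. $|\mathcal{GS}_n|$ equals the central Delannoy number $d_n$, with $\sum_nd_nx^n=1/\sqrt{1-6x+x^2}$. $a_n\sim b_n$ means $a_n/b_n\to1$. *)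

(* Defs.v *)
From HB Require Import structures.
From mathcomp Require Import all_boot.
From Stdlib Require Import ZArith Reals.

Set Implicit Arguments.
Unset Strict Implicit.
Unset Printing Implicit Defensive.

(** Steps U=(1,1), D=(1,-1), H=(2,0). *)
Inductive step := U | D | H.

Definition step_eqb (s t : step) : bool :=
  match s, t with U, U | D, D | H, H => true | _, _ => false end.

Lemma step_eqP : Equality.axiom step_eqb.
Proof. by case; case; constructor. Qed.

HB.instance Definition _ := hasDecEq.Build step step_eqP.

Definition step_width (s : step) : nat := match s with H => 2 | _ => 1 end.
Definition width (p : seq step) : nat := sumn (map step_width p).

(** The heights of the path at the integer abscissae 0,1,...,width p,
    starting at height y. (An H step from (x,y) passes through (x+1,y).) *)
Fixpoint heights (y : Z) (p : seq step) : seq Z :=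
  match p with
  | [::] => [:: y]
  | U :: q => y :: heights (y + 1)%Z q
  | D :: q => y :: heights (y - 1)%Z q
  | H :: q => y :: y :: heights y q
  end.

(** p is a path from (0,0) to (2n,0) with steps U, D, H (no positivity
    restriction: "grand" Schröder paths). *)
Definition is_GS (n : nat) (p : seq step) : bool :=
  (width p == 2 * n) && Z.eqb (last 0%Z (heights 0%Z p)) 0%Z.

Fixpoint all_paths (k : nat) : seq (seq step) :=
  match k with
  | 0 => [:: [::]]
  | k'.+1 => [::] :: [seq s :: t | s <- [:: U; D; H], t <- all_paths k']
  end.

(** The underlying (duplicate-free) list of elements of GS_n: every such path
    has at most 2n steps. *)
Definition GS (n : nat) : seq (seq step) := filter (is_GS n) (all_paths (2 * n)).

(** gamma1 <= gamma2 iff gamma1 lies weakly below gamma2; since both are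
    polygonal lines through lattice points at every integer abscissa, this is
    comparison of heights at the integer abscissae 0..2n. *)
Definition path_le (p q : seq step) : bool :=
  all2 Z.leb (heights 0%Z p) (heights 0%Z q).

(** Generic finite poset given by an order relation [le] on a duplicate-free
    list [P]: strict order, covering relation, number of Hasse edges, and
    the ratio i(P) = l(P)/|P|. *)
Definition strict {T : eqType} (le : rel T) (a b : T) : bool := (a != b) && le a b.

Definition covers {T : eqType} (le : rel T) (P : seq T) (a b : T) : bool :=
  strict le a b && ~~ has (fun c => strict le a c && strict le c b) P.

Definition ell {T : eqType} (le : rel T) (P : seq T) : nat :=
  count (fun ab => covers le P ab.1 ab.2) [seq (a, b) | a <- P, b <- P].

Definition i_ratio {T : eqType} (le : rel T) (P : seq T) : R :=
  (INR (ell le P) / INR (size P))%R.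

Definition ellGS (n : nat) : nat := ell path_le (GS n).
Definition iGS (n : nat) : R := i_ratio path_le (GS n).

(* Main.v *)
Require Import Defs.
From HB Require Import structures.
From mathcomp Require Import all_boot zify.
From Stdlib Require Import ZArith Reals Lia Lra.

Set Implicit Arguments.
Unset Strict Implicit.
Unset Printing Implicit Defensive.

(** Covers. If [a < b], follow [a] from the point where it leaves [b] down to the first step that is
    not D: there [a] has a valley DU or an H step that can be raised by one unit while staying
    below [b]. Hence the edges are exactly the moves H -> UD and DU -> H, i.e. one edge of each kind
    per H step of a path, and [ell (GS n)] is twice the total number of H steps. Counting paths by
    their number [k] of U steps gives the first sum.

    Closed forms. With [d n = size (GS n)], telescoping gives [ell n = n (d n + d (n - 1)) / 2] and
    the Legendre recurrence [(n + 2) d (n + 2) = 3 (2 n + 3) d (n + 1) - (n + 1) d n]. The sum of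
    [n! / (k!^2 (n - 2 k)!) 2^k 3^(n - 2k)] satisfies the same recurrence, whence the second sum.

    Analysis. The recurrence is a differential equation, so the series [F] of [d] satisfies
    [F sqrt (1 - 6 x + x^2) = 1]; the edge series is [(x F' + x^2 F' + x F) / 2]. Factoring
    [1 - 6 x + x^2 = (1 - rho x) (1 - x / rho)] exhibits [d] as the convolution of
    [w n rho^n] and [w n rho^-n] with [w n = 'C(2 n, n) / 4^n]; dominating [w (n - k) / w n] gives
    [d n ~ rho^n w n / sqrt (1 - rho^-2)], and Wallis' product gives [w n ~ 1 / sqrt (pi n)]. *)

(** * Covering pairs *)

Local Arguments Z.add : simpl never.
Local Arguments Z.sub : simpl never.
Local Arguments Z.of_nat : simpl never.

(** One entry per H step of [p]. With [w] = UD the entries are the paths obtained by raising one H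
    step, with [w] = DU those obtained by lowering one; both families are therefore counted by H
    steps. *)
Fixpoint replaceH (w p : seq step) : seq (seq step) :=
  match p with
  | [::] => [::]
  | s :: q =>
      (if s == H then [:: w ++ q] else [::]) ++ [seq s :: t | t <- replaceH w q]
  end.

Lemma size_replaceH w p : size (replaceH w p) = count_mem H p.
Proof. by elim: p => //= s q IH; rewrite size_cat size_map IH; case: (s == H). Qed.

(** Two entries differ at the earlier of the two replaced positions: one has [s] there, the other
    still has H. *)
Lemma uniq_replaceH s w p : s != H -> uniq (replaceH (s :: w) p).
Proof.
move=> sH; elim: p => //= t q IH; rewrite cat_uniq map_inj_uniq ?IH ?andbT; last by move=> ? ? [].
case: eqP => [->|_] /=; last by apply/hasPn.
apply/negP => /hasP[x /mapP[y _ ->]]; rewrite inE => /eqP[e].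
by rewrite -e eqxx in sH.
Qed.

Lemma mem_replaceH_cons w s q c :
  c \in replaceH w (s :: q) ->
  s = H /\ c = w ++ q \/ exists2 t, t \in replaceH w q & c = s :: t.
Proof.
rewrite /= mem_cat => /orP[|/mapP[t ht ->]]; last by right; exists t.
by case: eqP => [->|_]; rewrite ?inE ?in_nil // => /eqP ->; left.
Qed.

(** Serves as a rank function: it is strictly increasing for the order, and an elementary move
    changes it by exactly one, which leaves no room for an intermediate path. *)
Definition area (y : Z) (p : seq step) : Z := foldr Z.add 0%Z (heights y p).

Definition endpoint (p : seq step) : Z :=
  (Z.of_nat (count_mem U p) - Z.of_nat (count_mem D p))%Z.

Definition rise (s : step) : Z := match s with U => 1 | D => -1 | H => 0 end.

Lemma endpoint_cons s p : endpoint (s :: p) = (rise s + endpoint p)%Z.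
Proof.
by rewrite /endpoint; case: s; rewrite /= /eq_op /=; lia.
Qed.

Lemma last_heights x y p : last x (heights y p) = (y + endpoint p)%Z.
Proof.
elim: p x y => [|s p IH] x y; first by rewrite /endpoint /=; lia.
by rewrite endpoint_cons; case: s; rewrite /= !IH; lia.
Qed.

Lemma all2_leb_refl s : all2 Z.leb s s.
Proof. by elim: s => //= x s ->; rewrite Z.leb_refl. Qed.

(** The width and the endpoint keep the move inside [GS n], the area makes it a cover, and the size
    later tells the moves H -> UD from the moves DU -> H. *)
Lemma replaceUD_props p c : c \in replaceH [:: U; D] p ->
  [/\ size c = (size p).+1, width c = width p, endpoint c = endpoint p &
      forall y, all2 Z.leb (heights y p) (heights y c) /\ area y c = (area y p + 1)%Z].
Proof.
elim: p c => [|s q IH] c //; case/mem_replaceH_cons => [[-> ->]|[t /IH [h1 h2 h3 h4] ->]].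
  split=> [||| y] //; first by rewrite !endpoint_cons /=; lia.
  rewrite /area /=; have -> : (y + 1 - 1 = y)%Z by lia.
  by rewrite all2_leb_refl; split; lia.
have area_cons z x : area z x = foldr Z.add 0%Z (heights z x) by [].
split; rewrite /= ?h1 //.
- by rewrite /width /= -!/(width _) h2.
- by rewrite !endpoint_cons h3.
- by move=> y; case: s; rewrite /area /= -!area_cons ?Z.leb_refl /=;
    [case: (h4 (y + 1)%Z)|case: (h4 (y - 1)%Z)|case: (h4 y)] => -> ->; split=> //; lia.
Qed.

Lemma replaceDU_props p c : c \in replaceH [:: D; U] p ->
  [/\ size c = (size p).+1, width c = width p, endpoint c = endpoint p &
      forall y, all2 Z.leb (heights y c) (heights y p) /\ area y p = (area y c + 1)%Z].
Proof.
elim: p c => [|s q IH] c //; case/mem_replaceH_cons => [[-> ->]|[t /IH [h1 h2 h3 h4] ->]].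
  split=> [||| y] //; first by rewrite !endpoint_cons /=; lia.
  rewrite /area /=; have -> : (y - 1 + 1 = y)%Z by lia.
  by rewrite all2_leb_refl; split; lia.
have area_cons z x : area z x = foldr Z.add 0%Z (heights z x) by [].
split; rewrite /= ?h1 //.
- by rewrite /width /= -!/(width _) h2.
- by rewrite !endpoint_cons h3.
- by move=> y; case: s; rewrite /area /= -!area_cons ?Z.leb_refl /=;
    [case: (h4 (y + 1)%Z)|case: (h4 (y - 1)%Z)|case: (h4 y)] => -> ->; split=> //; lia.
Qed.

Lemma heights_cons y p : exists r, heights y p = y :: r.
Proof. by case: p => [|[] q] /=; eexists. Qed.

(** The second height, [y + 1], [y - 1] or [y], reveals whether the first step is U, D or H. *)
Lemma heights_inj y : injective (heights y).
Proof.
move=> p; elim: p y => [|s p IH] y [|t q] //.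
- have [r1 e1] := heights_cons (y + 1) q; have [r2 e2] := heights_cons (y - 1) q.
  by case: t => /=; rewrite ?e1 ?e2.
- have [r1 e1] := heights_cons (y + 1) p; have [r2 e2] := heights_cons (y - 1) p.
  by case: s => /=; rewrite ?e1 ?e2.
have [r1 e1] := heights_cons (y + 1) p; have [r2 e2] := heights_cons (y - 1) p.
have [r3 e3] := heights_cons (y + 1) q; have [r4 e4] := heights_cons (y - 1) q.
case: s; case: t => -[]; try (by move/IH => ->); rewrite ?e1 ?e2 ?e3 ?e4; case; lia.
Qed.

Lemma all2_leb_sum s t : all2 Z.leb s t ->
  (foldr Z.add 0 s <= foldr Z.add 0 t)%Z /\
  (foldr Z.add 0%Z s = foldr Z.add 0%Z t -> s = t).
Proof.
elim: s t => [|x s IH] [|z t] //=.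
move/andP => [/Z.leb_le xz /IH [h1 h2]].
split; first by lia.
move=> e; have e1 : x = z by lia.
by rewrite e1 h2 //; lia.
Qed.

Lemma strict_area a b : strict Defs.path_le a b -> (area 0 a < area 0 b)%Z.
Proof.
case/andP => /eqP nab /all2_leb_sum [h1 h2]; rewrite -!/(area _ _) in h1 h2.
by have := fun e => nab (@heights_inj 0%Z _ _ (h2 e)); lia.
Qed.

(** [above v s]: [s] is the tail, from some abscissa on, of the heights of a path passing
    strictly above height [v] there, where [v] has the parity of a vertex; so that tail starts
    either at a vertex of height at least [v + 2] or in the middle of an H step. *)
Definition above (v : Z) (s : seq Z) : Prop :=
  (exists w p, s = heights w p /\ (v + 2 <= w)%Z) \/
  (exists w p, s = w :: heights w p /\ (v + 1 <= w)%Z).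

(** The upper path loses at most one unit per abscissa, as does the bound [v]. In the middle of an H
    step the height is kept, so the margin 1 there becomes the margin 2 required at the next
    vertex. *)
Lemma above_behead v x s : above v (x :: s) -> s <> [::] -> above (v - 1) s.
Proof.
case=> [[w [[|[] p] /= [[_ ->] h]]]|[w [p [[_ ->] h]]]] // _.
- by left; exists (w + 1)%Z, p; split=> //; lia.
- by left; exists (w - 1)%Z, p; split=> //; lia.
- by right; exists w, p; split=> //; lia.
- by left; exists w, p; split=> //; lia.
Qed.

Lemma above_head v x s : above v (x :: s) -> (v + 1 <= x)%Z.
Proof.
case=> [[w [p]]|[w [p]]]; last by case=> -[-> _].
by case: (heights_cons w p) => r -> [[-> _]]; lia.
Qed.

Lemma above_second v x z s : above v [:: x, z & s] -> (v + 1 <= z)%Z.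
Proof.
case=> [[w [p [e h]]]|[w [p [e h]]]]; last first.
  by have [r er] := heights_cons w p; move: e; rewrite er => -[_ -> _]; lia.
case: p e => [|[] p] //= [_].
- by have [r er] := heights_cons (w + 1) p; rewrite er => -[-> _]; lia.
- by have [r er] := heights_cons (w - 1) p; rewrite er => -[-> _]; lia.
- by move=> -> _; lia.
Qed.

(** Here the lower path has just descended from [v + 1] to [v], and [s] is the rest of the upper
    path. Follow the D steps of [q]: the first other step is either U, forming a valley DU that
    becomes H, or H, which becomes UD. One of them exists because the two paths meet at the end. The
    head [v + 1] is split off in the conclusion because [s] begins one abscissa later. *)
Lemma up_move_after_D q v s :
  all2 Z.leb (heights v q) s -> last v (heights v q) = last v s -> above v s ->
  exists2 c, c \in replaceH [:: U; D] (D :: q) \/ D :: q \in replaceH [:: D; U] c &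
             exists2 t, heights (v + 1) c = (v + 1)%Z :: t & all2 Z.leb t s.
Proof.
elim: q v s => [|e q IH] v [|x s] //=.
- by case: s => [|z s] /=; rewrite ?andbF // => _ -> /above_head; lia.
- by case: e => //=; rewrite ?andbF.
case: e => /=.
- case/andP => _ hs _ /above_head/Z.leb_le hx.
  exists (H :: q); first by right; rewrite /= mem_head.
  by exists ((v + 1)%Z :: heights (v + 1) q) => //=; rewrite hx hs.
- case/andP => /Z.leb_le vx hs el ab.
  have s0 : s <> [::] by case: (heights_cons (v - 1) q) hs => r ->; case: (s).
  have el' : last (v - 1)%Z (heights (v - 1) q) = last (v - 1)%Z s.
    by move: el; rewrite !last_heights; case: (s) s0 => //= *; rewrite last_heights.
  case: (IH _ _ hs el' (above_behead ab s0)) => c hc [t ht hts].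
  exists (D :: c).
    by case: hc => hc; [left|right]; apply: map_f.
  exists (heights v c); first by rewrite /=; congr (_ :: heights _ _); lia.
  have e1 : (v - 1 + 1 = v)%Z by lia.
  by rewrite -e1 ht e1 /= hts andbT; apply/Z.leb_le.
- case: s => [|z s]; first by rewrite andbF.
  case/andP => hx /andP[_ hs] _ /above_second/Z.leb_le hz.
  exists (D :: U :: D :: q); first by left; rewrite /= mem_head.
  exists [:: v, (v + 1)%Z & heights v q]; last by rewrite /= hx hz.
  by rewrite /=; congr [:: _, _, _ & heights _ _]; try lia; congr cons; lia.
Qed.

(** Strip the common prefix. At the first difference [a] must go below [b]: either H against U, and
    that H is raised at once, or D against U or H, and [up_move_after_D] applies. The remaining
    three pairs of steps contradict the order. *)
Lemma exists_up_move y a b :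
  all2 Z.leb (heights y a) (heights y b) -> a <> b -> endpoint a = endpoint b ->
  exists2 c, c \in replaceH [:: U; D] a \/ a \in replaceH [:: D; U] c &
             all2 Z.leb (heights y c) (heights y b).
Proof.
elim: a y b => [|s p IH] y [|t q] //.
- by case: t; rewrite /= ?andbF //;
    [case: (heights_cons (y + 1) q)|case: (heights_cons (y - 1) q)] => r ->;
    rewrite /= ?andbF.
- by case: s {IH}; rewrite /= ?andbF //;
    [case: (heights_cons (y + 1) p)|case: (heights_cons (y - 1) p)] => r ->;
    rewrite /= ?andbF.
rewrite !endpoint_cons.
have [<- /= le_pq ne_pq e|/eqP st le_pq _ e] := eqVneq s t.
  have ne : p <> q by move=> e'; apply: ne_pq; rewrite e'.
  have e' : endpoint p = endpoint q by lia.
  pose z := (y + rise s)%Z.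
  have hz : all2 Z.leb (heights z p) (heights z q).
    by rewrite /z; case: (s) le_pq => /=; rewrite ?Z.add_0_r; [case/andP|case/andP|case/and3P].
  case: (IH z q hz ne e') => c hc hcq; exists (s :: c).
    case: hc => hc; [left|right]; rewrite /= mem_cat; apply/orP; right; exact: map_f.
  move: hcq; by rewrite /z; case: (s) => /=; rewrite ?Z.add_0_r !Z.leb_refl.
have [r1 e1] := heights_cons (y + 1) p.
have D_case z : heights y (t :: q) = y :: z -> s = D -> above (y - 1) z ->
  exists2 c, c \in replaceH [:: U; D] (s :: p) \/ s :: p \in replaceH [:: D; U] c &
             all2 Z.leb (heights y c) (heights y (t :: q)).
  move=> ez es ab; move: le_pq e; rewrite es ez => /= /andP[_ hz] e.
  have el : last (y - 1)%Z (heights (y - 1) p) = last (y - 1)%Z z.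
    have := last_heights (y - 1) y (t :: q); rewrite ez endpoint_cons /= last_heights.
    case: (z) hz => [|? ?] /=; last by lia.
    by case: (heights_cons (y - 1) p) => ? ->.
  case: (up_move_after_D hz el ab) => c hc [u hu huz].
  exists c => //; have : (y - 1 + 1 = y)%Z by lia.
  by move=> ey; rewrite ey in hu; rewrite hu /= Z.leb_refl.
case: s t st le_pq e D_case => -[] //= _ le_pq e D_case.
- by move: le_pq; case: (heights_cons (y - 1) q) => r2 ->;
    rewrite e1 Z.leb_refl /= => /andP[/Z.leb_le]; lia.
- by move: le_pq; rewrite e1 Z.leb_refl /= => /andP[/Z.leb_le]; lia.
- by apply: (D_case _ erefl) => //; left; exists (y + 1)%Z, q; split=> //; lia.
- by apply: (D_case _ erefl) => //; right; exists y, q; split=> //; lia.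
- exists [:: U, D & p]; first by left; rewrite mem_head.
  have ey : (y + 1 - 1 = y)%Z by lia.
  move: le_pq; rewrite /= ey Z.leb_refl; case: (heights_cons (y + 1) q) => r2 -> /=.
  by rewrite Z.leb_refl => /andP[].
- by move: le_pq; case: (heights_cons (y - 1) q) => r2 ->;
    rewrite Z.leb_refl /= => /andP[/Z.leb_le]; lia.
Qed.

Lemma is_GSE n p : is_GS n p = (width p == 2 * n) && Z.eqb (endpoint p) 0.
Proof. by rewrite /is_GS last_heights. Qed.

Lemma mem_all_paths k p : (p \in all_paths k) = (size p <= k).
Proof.
elim: k p => [|k IH] p; first by case: p.
rewrite /= !inE; case: p => [|s p] //=.
rewrite !mem_cat in_nil orbF ltnS -IH.
have mem_cons x y : ((x :: p) \in [seq y :: t | t <- all_paths k]) = (x == y) && (p \in all_paths k).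
  apply/mapP/andP => [[t ht [-> ->]]|[/eqP -> hp]]; [by rewrite eqxx|by exists p].
by rewrite !mem_cons; case: s; rewrite /= ?orbF.
Qed.

Lemma uniq_all_paths k : uniq (all_paths k).
Proof.
elim: k => // k IH /=; apply/andP; split.
  by rewrite !mem_cat in_nil orbF !negb_or; apply/and3P; split; apply/mapP => -[].
by apply: (@allpairs_uniq _ _ _ cons [:: U; D; H]) => // -[x s] [y t] _ _ /= [-> ->].
Qed.

Lemma size_le_width p : size p <= width p.
Proof. by rewrite /width; elim: p => // s p IH; case: s => /=; lia. Qed.

Lemma mem_GS n p : (p \in GS n) = is_GS n p.
Proof.
rewrite mem_filter mem_all_paths; case h: (is_GS n p) => //=.
by case/andP: h => /eqP <- _; apply: size_le_width.
Qed.

Lemma uniq_GS n : uniq (GS n).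
Proof. by rewrite filter_uniq ?uniq_all_paths. Qed.

(** If [b] covers [a], the path given by [exists_up_move] lies in [GS n], strictly above [a] and
    weakly below [b], hence is [b]. Conversely, an elementary move adds one to the area, whereas an
    intermediate path would force an increase of at least two. *)
Lemma covers_GS n a b : a \in GS n -> b \in GS n ->
  covers Defs.path_le (GS n) a b = (b \in replaceH [:: U; D] a) || (a \in replaceH [:: D; U] b).
Proof.
rewrite !mem_GS => ha hb; apply/andP/idP => [[/andP[/eqP nab le_ab] /hasPn hc]|hab].
  have e : endpoint a = endpoint b.
    by move: ha hb; rewrite !is_GSE => /andP[_ /Z.eqb_eq ->] /andP[_ /Z.eqb_eq ->].
  case: (exists_up_move le_ab nab e) => c hac le_cb.
  have [<-|ncb] := eqVneq c b; first by apply/orP.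
  have hcG : c \in GS n.
    rewrite mem_GS is_GSE; move: ha; rewrite is_GSE.
    by case: hac => [/replaceUD_props|/replaceDU_props] [_ -> -> _].
  case/negP: (hc c hcG); apply/andP; split; apply/andP; split=> //.
    by apply/eqP => eac; case: hac; rewrite eac; [case/replaceUD_props|case/replaceDU_props] => /n_Sn.
  by case: hac => [/replaceUD_props|/replaceDU_props] [_ _ _ /(_ 0%Z) []].
have [le_ab ar] : Defs.path_le a b /\ area 0 b = (area 0 a + 1)%Z.
  by case/orP: hab => [/replaceUD_props|/replaceDU_props] [_ _ _ /(_ 0%Z) []].
split.
  apply/andP; split=> //; apply/eqP => eab; rewrite eab in ar; lia.
by apply/hasPn => c _; apply/negP => /andP[/strict_area h1 /strict_area h2]; lia.
Qed.

Lemma sum_mem_uniq (T : eqType) (P s : seq T) : uniq P -> uniq s -> {subset s <= P} ->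
  \sum_(b <- P) (b \in s : nat) = size s.
Proof.
move=> uP us sP; rewrite -big_mkcond /= sum1_count -size_filter; apply: perm_size.
apply: uniq_perm; rewrite ?filter_uniq // => x; rewrite mem_filter.
by case h: (x \in s) => //=; apply: sP.
Qed.

Lemma ellGS_countH n : ellGS n = 2 * \sum_(p <- GS n) count_mem H p.
Proof.
rewrite /ellGS /ell -sum1_count big_mkcond big_allpairs /=.
have subR w p : w \in [:: [:: U; D]; [:: D; U]] -> p \in GS n ->
    {subset replaceH w p <= GS n}.
  move=> hw; rewrite mem_GS => hp c hc; rewrite mem_GS is_GSE; move: hp; rewrite is_GSE.
  by move: hw hc; rewrite !inE => /orP[] /eqP -> => [/replaceUD_props|/replaceDU_props] [_ -> ->].
transitivity (\sum_(a <- GS n) \sum_(b <- GS n)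
   ((b \in replaceH [:: U; D] a : nat) + (a \in replaceH [:: D; U] b))).
  rewrite big_seq [RHS]big_seq; apply: eq_bigr => a ha.
  rewrite big_seq [RHS]big_seq; apply: eq_bigr => b hb.
  rewrite covers_GS //; case h1: (b \in _); case h2: (a \in _) => //.
  (* The two kinds of move exclude each other: H -> UD lengthens the upper path by one step and DU
     -> H shortens it by one. *)
  case/replaceUD_props: h1 => + _ _ _; case/replaceDU_props: h2 => + _ _ _ => -> /eqP.
  by rewrite -[X in X == _]addn0 -addn2 eqn_add2l.
under eq_bigr do rewrite big_split /=.
(* Moves H -> UD are grouped by their lower path and moves DU -> H by their upper path, so that
   either inner sum counts the H steps of the path kept fixed. *)
rewrite big_split /= [X in _ + X]exchange_big /= mul2n -addnn; congr addn.
all: rewrite big_seq [RHS]big_seq; apply: eq_bigr => p hp.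
all: rewrite sum_mem_uniq ?size_replaceH ?uniq_GS ?uniq_replaceH //; exact: subR.
Qed.

(** * Enumeration of the paths *)

Lemma size_count p : size p = count_mem U p + count_mem D p + count_mem H p.
Proof. by elim: p => //= s p ->; case: s; rewrite /= /eq_op /=; lia. Qed.

Lemma width_count p : width p = count_mem U p + count_mem D p + 2 * count_mem H p.
Proof. by rewrite /width; elim: p => //= s p ->; case: s; rewrite /= /eq_op /=; lia. Qed.

Fixpoint words (m : nat) : seq (seq step) :=
  if m is m'.+1 then
    map (cons U) (words m') ++ map (cons D) (words m') ++ map (cons H) (words m')
  else [:: [::]].

Lemma mem_words m p : (p \in words m) = (size p == m).
Proof.
elim: m p => [|m IH] [|s p] //=; rewrite !mem_cat.
  by apply/negbTE; rewrite !negb_or; apply/and3P; split; apply/mapP => -[].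
rewrite eqSS -IH.
have mem_cons x y : ((x :: p) \in [seq y :: t | t <- words m]) = (x == y) && (p \in words m).
  apply/mapP/andP => [[t ht [-> ->]]|[/eqP -> hp]]; [by rewrite eqxx|by exists p].
by rewrite !mem_cons; case: s; rewrite /= ?orbF.
Qed.

Lemma uniq_words m : uniq (words m).
Proof.
elim: m => // m IH /=.
have disj x y : x != y -> ~~ has (mem (map (cons x) (words m))) (map (cons y) (words m)).
  by move=> xy; apply/hasPn => _ /mapP[t _ ->]; apply/mapP => -[u _ [e _]]; rewrite e eqxx in xy.
rewrite !cat_uniq has_cat negb_or !disj // !map_inj_uniq ?IH //; by move=> ? ? [].
Qed.

(** Choose the positions of the steps other than H, then those of the U steps among them. The
    induction splits by first letter and closes with Pascal's rule. *)
Lemma count_words m u d :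
  count (fun p => (count_mem U p == u) && (count_mem D p == d)) (words m) =
  'C(m, u + d) * 'C(u + d, u).
Proof.
elim: m u d => [|m IH] u d; first by case: u d => [|u] [|d].
rewrite /= !count_cat !count_map.
rewrite -[X in _ + (_ + X)]/(count (fun p => (count_mem U p == u) && (count_mem D p == d))
  (words m)) IH.
have -> : count (preim (cons U) (fun p => (count_mem U p == u) && (count_mem D p == d))) (words m)
  = if u is u'.+1 then 'C(m, u' + d) * 'C(u' + d, u') else 0.
  by case: u => [|u]; [rewrite -[RHS](count_pred0 (words m)); apply: eq_count|rewrite -IH].
have -> : count (preim (cons D) (fun p => (count_mem U p == u) && (count_mem D p == d))) (words m)
  = if d is d'.+1 then 'C(m, u + d') * 'C(u + d', u) else 0.
  case: d => [|d]; last by rewrite -IH.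
  by rewrite -[RHS](count_pred0 (words m)); apply: eq_count => p; rewrite /= andbF.
case: u d => [|u] [|d]; rewrite ?addn0 ?add0n ?bin0 ?bin1 ?binn //= ?muln1; last first.
- rewrite addSnnS !addnS !addSn !binS; nia.
- by rewrite binS; lia.
- by rewrite binS; lia.
Qed.

(** A path of [GS n] with [k] U steps has [k] D steps and [n - k] H steps, hence length [n + k]. *)
Lemma GS_wordsE n k : k <= n ->
  perm_eq [seq p <- GS n | count_mem U p == k]
          [seq p <- words (n + k) | (count_mem U p == k) && (count_mem D p == k)].
Proof.
move=> kn; apply: uniq_perm => [||p]; [exact/filter_uniq/uniq_GS|exact/filter_uniq/uniq_words|].
rewrite mem_filter mem_GS mem_filter mem_words is_GSE width_count size_count /endpoint; lia.
Qed.

Lemma countU_GS n p : p \in GS n -> count_mem U p <= n.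
Proof. by rewrite mem_GS is_GSE width_count /endpoint; lia. Qed.

(** Two instances matter: [F] constant 1 gives the size of [GS n], and the identity gives the total
    number of H steps. *)
Lemma sum_GS n (F : nat -> nat) :
  \sum_(p <- GS n) F (count_mem H p) = \sum_(k < n.+1) 'C(n + k, 2 * k) * 'C(2 * k, k) * F (n - k).
Proof.
transitivity (\sum_(p <- GS n) \sum_(k < n.+1 | count_mem U p == k) F (count_mem H p)).
  rewrite big_seq [RHS]big_seq; apply: eq_bigr => p /countU_GS hp.
  by rewrite (big_pred1 (Ordinal (hp : count_mem U p < n.+1))) // => i; rewrite eq_sym.
rewrite (exchange_big_dep predT) //=; apply: eq_bigr => -[k /=]; rewrite ltnS => hk _.
rewrite -big_filter (perm_big _ (GS_wordsE hk)) /= mul2n -addnn -count_words -size_filter.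
rewrite -[X in X * _]sum1_size big_distrl /= big_seq [RHS]big_seq; apply: eq_bigr => p.
rewrite mem_filter mem_words => /andP[/andP[/eqP hU /eqP hD]] /eqP.
by rewrite size_count hU hD mul1n addnAC => /addIn <-; rewrite addKn.
Qed.

(** * Closed forms *)

Local Open Scope R_scope.

Lemma INR_addn m n : INR (m + n)%nat = INR m + INR n.
Proof. exact: plus_INR. Qed.

Lemma INR_muln m n : INR (m * n)%nat = INR m * INR n.
Proof. exact: mult_INR. Qed.

Lemma INR_subn m n : (n <= m)%nat -> INR (m - n)%nat = INR m - INR n.
Proof. by move=> h; apply: minus_INR; apply/leP. Qed.

Lemma INRS n : INR n.+1 = INR n + 1.
Proof. exact: S_INR. Qed.

Lemma sum_f_R0_S f n : sum_f_R0 f n.+1 = sum_f_R0 f n + f n.+1.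
Proof. by []. Qed.

Lemma sum_f_R0_stable f m n : (m <= n)%nat -> (forall k, (m < k)%nat -> f k = 0) ->
  sum_f_R0 f n = sum_f_R0 f m.
Proof.
move=> mn f0; elim: n mn => [|n IH]; first by rewrite leqn0 => /eqP ->.
rewrite leq_eqVlt => /orP[/eqP -> //|]; rewrite ltnS => mn.
by rewrite sum_f_R0_S IH // f0 // Rplus_0_r.
Qed.

Lemma INR_sum_ord (F : nat -> nat) n :
  INR (\sum_(k < n.+1) F k)%nat = sum_f_R0 (fun k => INR (F k)) n.
Proof.
elim: n => [|n IH]; first by rewrite big_ord_recl big_ord0 addn0.
by rewrite big_ord_recr /= INR_addn IH.
Qed.

(** For integral [x = n], this is [(n + k)! / ((n - k)! k!^2)]; a real argument makes the
    contiguity relations in [x] free of truncated subtraction. *)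
Fixpoint delannoy_term (x : R) (k : nat) : R :=
  match k with
  | 0%nat => 1
  | k'.+1 => delannoy_term x k' * (x + INR k' + 1) * (x - INR k') / (INR k' + 1) ^ 2
  end.

Lemma delannoy_termS x k : delannoy_term x k.+1 =
  delannoy_term x k * (x + INR k + 1) * (x - INR k) / (INR k + 1) ^ 2.
Proof. by []. Qed.

Lemma delannoy_term_large n k : (n < k)%nat -> delannoy_term (INR n) k = 0.
Proof.
elim: k => // k IH; rewrite ltnS leq_eqVlt => /orP[/eqP <-|/IH h] /=;
  last by rewrite h /Rdiv !Rmult_0_l.
by rewrite Rminus_diag /Rdiv; ring.
Qed.

Lemma delannoy_termE n k : INR 'C(n + k, 2 * k) * INR 'C(2 * k, k) = delannoy_term (INR n) k.
Proof.
case: (leqP k n) => [|nk]; last first.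
  rewrite delannoy_term_large // (_ : 'C(n + k, 2 * k) = 0%nat) ?Rmult_0_l //.
  by apply: bin_small; lia.
elim: k => [|k IH] kn; first by rewrite muln0 !bin0 /=; ring.
have k0 := pos_INR k.
rewrite [delannoy_term _ _]/= -IH; last by lia.
(* [e1] and [e2] raise the lower index of the first binomial from [2k] to [2k + 2]; [e3] and [e4]
   pass from the central binomial of [k] to that of [k + 1]. *)
have e1 : INR (2 * k + 2) * INR 'C(n + k.+1, 2 * k.+1) = INR (n + k).+1 * INR 'C(n + k, 2 * k + 1).
  rewrite -!INR_muln addnS; congr INR; rewrite (mul_bin_diag (n + k).+1).
  by congr (_ * 'C(_, _))%nat; lia.
have e2 : INR (2 * k + 1) * INR 'C(n + k, 2 * k + 1) = INR (n - k) * INR 'C(n + k, 2 * k).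
  rewrite -!INR_muln; congr INR; rewrite addn1 mul_bin_left; congr muln; lia.
have e3 : INR k.+1 * INR 'C(2 * k.+1, k.+1) = INR (2 * k + 2) * INR 'C(2 * k + 1, k).
  rewrite -!INR_muln; congr INR; rewrite -mul_bin_diag; congr (_ * 'C(_, _))%nat; lia.
have e4 : INR k.+1 * INR 'C(2 * k + 1, k) = INR (2 * k + 1) * INR 'C(2 * k, k).
  rewrite -!INR_muln; congr INR; transitivity ((2 * k + 1 - k) * 'C(2 * k + 1, k))%nat.
    by congr muln; lia.
  by rewrite -mul_bin_down; congr (_ * 'C(_, _))%nat; lia.
have i1 : INR (2 * k + 1) = 2 * INR k + 1 by rewrite INR_addn INR_muln.
have i2 : INR (2 * k + 2) = 2 * INR k + 2 by rewrite INR_addn INR_muln.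
move: e1 e2 e3 e4; rewrite i1 i2 (INR_subn (ltnW kn)) !INRS INR_addn.
set X := INR 'C(n + k.+1, _); set Y := INR 'C(n + k, 2 * k + 1); set Z := INR 'C(2 * k.+1, _).
set W := INR 'C(2 * k + 1, k); set a := INR 'C(n + k, 2 * k); set c := INR 'C(2 * k, k).
move: X Y Z W a c => X Y Z W a c e1 e2 e3 e4.
have -> : X = (INR n + INR k + 1) * Y / (2 * INR k + 2) by rewrite -e1; field; lra.
have -> : Y = (INR n - INR k) * a / (2 * INR k + 1) by rewrite -e2; field; lra.
have -> : Z = 2 * W by apply: (Rmult_eq_reg_l (INR k + 1)); lra.
have -> : W = (2 * INR k + 1) * c / (INR k + 1)
  by apply: (Rmult_eq_reg_l (INR k + 1)); [rewrite e4; field|]; lra.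
field; lra.
Qed.

Lemma delannoy_term_succ x k : delannoy_term (x + 1) k.+1 =
  (x + INR k + 1) * (x + INR k + 2) * delannoy_term x k / (INR k + 1) ^ 2.
Proof.
elim: k => [|k IH]; first by rewrite /=; field.
have k0 := pos_INR k.
rewrite delannoy_termS IH [delannoy_term x k.+1]delannoy_termS !INRS.
by field; lra.
Qed.

Lemma delannoy_term_pred x k : delannoy_term (x - 1) k.+1 =
  (x - INR k - 1) * (x - INR k) * delannoy_term x k / (INR k + 1) ^ 2.
Proof.
elim: k => [|k IH]; first by rewrite /=; field.
have k0 := pos_INR k.
rewrite delannoy_termS IH [delannoy_term x k.+1]delannoy_termS !INRS.
by field; lra.
Qed.

(** The identity holds term by term: by contiguity the three terms of index [k + 1] are rational
    multiples of [delannoy_term x k]. At [x = n + 1], with all sums extended to full range, it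
    becomes the Legendre recurrence. *)
Lemma delannoy_term_sum_rec x n :
  (x + 1) * sum_f_R0 (delannoy_term (x + 1)) n.+1 - (2 * x + 1) * sum_f_R0 (delannoy_term x) n.+1
  + x * sum_f_R0 (delannoy_term (x - 1)) n.+1 = 2 * (2 * x + 1) * sum_f_R0 (delannoy_term x) n.
Proof.
have step k : (x + 1) * delannoy_term (x + 1) k.+1 - (2 * x + 1) * delannoy_term x k.+1
  + x * delannoy_term (x - 1) k.+1 = 2 * (2 * x + 1) * delannoy_term x k.
  have k0 := pos_INR k.
  by rewrite delannoy_term_succ delannoy_term_pred [delannoy_term x k.+1]delannoy_termS; field; lra.
elim: n => [|n IH].
  by rewrite !sum_f_R0_S; have := step 0%nat; rewrite [delannoy_term _ 0]/= /=; lra.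
rewrite ![sum_f_R0 _ n.+2]sum_f_R0_S [in RHS]sum_f_R0_S.
by have := step n.+1; lra.
Qed.

(** Creative telescoping; the right-hand side vanishes at [x = n]. *)
Lemma delannoy_term_telescope x n :
  sum_f_R0 (fun k => delannoy_term x k * (3 * x - 4 * INR k) - x * delannoy_term (x - 1) k) n =
  2 * (x - INR n) * delannoy_term x n.
Proof.
elim: n => [|n IH]; first by rewrite /=; ring.
have n0 := pos_INR n.
by rewrite sum_f_R0_S IH delannoy_term_pred [delannoy_term x n.+1]delannoy_termS !INRS; field; lra.
Qed.

Definition delannoy (n : nat) : R := sum_f_R0 (delannoy_term (INR n)) n.

Lemma delannoy_sum n m : (n <= m)%nat -> sum_f_R0 (delannoy_term (INR n)) m = delannoy n.
Proof. by move=> nm; apply: sum_f_R0_stable => // k; apply: delannoy_term_large. Qed.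

Lemma delannoy_rec n :
  (INR n + 2) * delannoy n.+2 = 3 * (2 * INR n + 3) * delannoy n.+1 - (INR n + 1) * delannoy n.
Proof.
have := delannoy_term_sum_rec (INR n.+1) n.+1.
have -> : INR n.+1 + 1 = INR n.+2 by rewrite !INRS.
have -> : INR n.+1 - 1 = INR n by rewrite INRS; ring.
by rewrite !delannoy_sum ?INRS; [lra|lia ..].
Qed.

Lemma size_GS n : INR (size (GS n)) = delannoy n.
Proof.
rewrite -sum1_size (sum_GS n (fun=> 1%nat)).
rewrite (INR_sum_ord (fun k => 'C(n + k, 2 * k) * 'C(2 * k, k) * 1)%nat); apply: sum_eq => k _.
by rewrite muln1 INR_muln delannoy_termE.
Qed.

Lemma ellGS_binomial n : INR (ellGS n) =
  2 * sum_f_R0 (fun k => INR 'C(n + k, 2 * k) * INR 'C(2 * k, k) * INR (n - k)) n.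
Proof.
rewrite ellGS_countH (sum_GS n ssrfun.id) INR_muln.
rewrite (INR_sum_ord (fun k => 'C(n + k, 2 * k) * 'C(2 * k, k) * (n - k))%nat); congr Rmult.
by apply: sum_eq => k _; rewrite !INR_muln.
Qed.

Lemma ellGS0 : ellGS 0 = 0%nat.
Proof. by rewrite ellGS_countH (sum_GS 0 ssrfun.id) big_ord_recl big_ord0. Qed.

Lemma ellGS_delannoy n :
  INR (ellGS n.+1) = (INR n + 1) * (delannoy n.+1 + delannoy n) / 2.
Proof.
rewrite ellGS_binomial.
rewrite (sum_eq _ (fun k => delannoy_term (INR n.+1) k * (INR n.+1 - INR k))); last first.
  by move=> k /leP hk; rewrite delannoy_termE INR_subn.
have := delannoy_term_telescope (INR n.+1) n.+1.
(* Since [3x - 4k = 4(x - k) - x], the telescoped sum is four times the edge sum minus [x] times two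
   Delannoy sums; at [x = n + 1] it is zero. *)
have e x m :
  sum_f_R0 (fun k => delannoy_term x k * (3 * x - 4 * INR k) - x * delannoy_term (x - 1) k) m
  = 4 * sum_f_R0 (fun k => delannoy_term x k * (x - INR k)) m
    - x * (sum_f_R0 (delannoy_term x) m + sum_f_R0 (delannoy_term (x - 1)) m).
  by elim: m => [|m IH]; rewrite ?sum_f_R0_S ?IH /=; ring.
have x1 : INR n.+1 - 1 = INR n by rewrite INRS; ring.
rewrite e x1 Rminus_diag Rmult_0_r Rmult_0_l !delannoy_sum // -INRS; lra.
Qed.

(** For integral [x = n], this is [n! / (k!^2 (n - 2k)!) (2/9)^k]. *)
Fixpoint trinomial_term (x : R) (k : nat) : R :=
  match k with
  | 0%nat => 1
  | k'.+1 =>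
      trinomial_term x k' * (x - 2 * INR k') * (x - 2 * INR k' - 1) * (2 / 9) / (INR k' + 1) ^ 2
  end.

Lemma trinomial_termS x k : trinomial_term x k.+1 =
  trinomial_term x k * (x - 2 * INR k) * (x - 2 * INR k - 1) * (2 / 9) / (INR k + 1) ^ 2.
Proof. by []. Qed.

Lemma trinomial_termE n k : INR 'C(n, k) * INR 'C(n - k, k) * (2 / 9) ^ k = trinomial_term (INR n) k.
Proof.
elim: k => [|k IH]; first by rewrite !bin0 /=; ring.
have k0 := pos_INR k.
rewrite trinomial_termS -IH -tech_pow_Rmult.
have e1 : INR k.+1 * INR 'C(n, k.+1) = INR (n - k) * INR 'C(n, k).
  by rewrite -!INR_muln mul_bin_left.
(* Truncated subtraction is harmless only for [n > 2k]. At [n = 2k] both sides vanish through the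
   factor [x - 2k], and for [n < 2k] the binomials themselves vanish. *)
case: (leqP (2 * k).+1 n) => [kn|].
  have e2 : INR k.+1 * INR 'C(n - k.+1, k.+1) = INR (n - k.+1 - k) * INR 'C(n - k.+1, k).
    by rewrite -!INR_muln mul_bin_left.
  have e3 : INR (n - k) * INR 'C(n - k.+1, k) = INR (n - k - k) * INR 'C(n - k, k).
    by rewrite -!INR_muln subnS mul_bin_down.
  move: e1 e2 e3; rewrite !INR_subn ?INRS; try lia.
  move: (INR 'C(n, k.+1)) (INR 'C(n - k.+1, k.+1)) (INR 'C(n - k.+1, k))
    (INR 'C(n, k)) (INR 'C(n - k, k)).
  move=> X Y Z a b e1 e2 e3.
  apply: (Rmult_eq_reg_l ((INR k + 1) ^ 2)); last by apply: pow_nonzero; lra.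
  transitivity (((INR k + 1) * X) * ((INR k + 1) * Y) * (2 / 9 * (2 / 9) ^ k)); first by ring.
  rewrite e1 e2.
  transitivity (((INR n - INR k) * Z) * a * (INR n - (INR k + 1) - INR k) * (2 / 9 * (2 / 9) ^ k)); first by ring.
  by rewrite e3; field; lra.
rewrite ltnS leq_eqVlt => /orP[/eqP ->|kn].
  rewrite (_ : 'C(2 * k - k.+1, k.+1) = 0%nat); last by apply: bin_small; lia.
  by rewrite INR_muln /=; field; lra.
rewrite (_ : 'C(n - k.+1, k.+1) = 0%nat); last by apply: bin_small; lia.
rewrite (_ : 'C(n - k, k) = 0%nat); last by apply: bin_small; lia.
by rewrite /=; field; lra.
Qed.

Lemma trinomial_term_large n k : (n < 2 * k)%nat -> trinomial_term (INR n) k = 0.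
Proof.
move=> nk; rewrite -trinomial_termE (_ : 'C(n - k, k) = 0%nat); last by apply: bin_small; lia.
by rewrite Rmult_0_r Rmult_0_l.
Qed.

Lemma trinomial_term_pred x k : x * trinomial_term (x - 1) k = (x - 2 * INR k) * trinomial_term x k.
Proof.
elim: k => [|k IH]; first by rewrite /=; ring.
have k0 := pos_INR k.
rewrite !trinomial_termS INRS.
transitivity (x * trinomial_term (x - 1) k * (x - 1 - 2 * INR k) * (x - 1 - 2 * INR k - 1) * (2 / 9)
  / (INR k + 1) ^ 2); first by field; lra.
by rewrite IH; field; lra.
Qed.

Lemma trinomial_term_succ x k : trinomial_term (x + 1) k.+1 =
  (x + 1) * x * trinomial_term (x - 1) k * (2 / 9) / (INR k + 1) ^ 2.
Proof.
elim: k => [|k IH]; first by rewrite /=; field.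
have k0 := pos_INR k.
by rewrite trinomial_termS IH trinomial_termS !INRS; field; lra.
Qed.

Lemma trinomial_term_pred_succ x k : trinomial_term x k.+1 =
  x * (x - 1 - 2 * INR k) * trinomial_term (x - 1) k * (2 / 9) / (INR k + 1) ^ 2.
Proof.
have k0 := pos_INR k; rewrite trinomial_termS.
transitivity ((x - 2 * INR k) * trinomial_term x k * (x - 2 * INR k - 1) * (2 / 9) / (INR k + 1) ^ 2).
  by field; lra.
by rewrite -trinomial_term_pred; field; lra.
Qed.

(** Division by [3^n] turns the Legendre recurrence into [(x + 1) s(x + 1) = (2x + 1) s(x) - x s(x -
    1) / 9]. The identity here is this one with [x s(x - 1)] added to both sides, up to boundary
    terms, and it again holds term by term. *)
Lemma trinomial_term_sum_rec x n :
  (x + 1) * sum_f_R0 (trinomial_term (x + 1)) n.+1 - (2 * x + 1) * sum_f_R0 (trinomial_term x) n.+1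
  + x * sum_f_R0 (trinomial_term (x - 1)) n.+1 = 8 / 9 * x * sum_f_R0 (trinomial_term (x - 1)) n.
Proof.
have step k : (x + 1) * trinomial_term (x + 1) k.+1 - (2 * x + 1) * trinomial_term x k.+1
  + x * trinomial_term (x - 1) k.+1 = 8 / 9 * x * trinomial_term (x - 1) k.
  have k0 := pos_INR k.
  by rewrite trinomial_term_succ trinomial_term_pred_succ trinomial_termS; field; lra.
elim: n => [|n IH].
  by rewrite !sum_f_R0_S; have := step 0%nat; rewrite [trinomial_term _ 0]/= /=; lra.
rewrite ![sum_f_R0 _ n.+2]sum_f_R0_S [in RHS]sum_f_R0_S.
by have := step n.+1; lra.
Qed.

Lemma trinomial_sum n m : (n <= 2 * m)%nat ->
  sum_f_R0 (trinomial_term (INR n)) m = sum_f_R0 (trinomial_term (INR n)) (n./2).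
Proof.
move=> nm; apply: sum_f_R0_stable => [|k hk]; first by lia.
by apply: trinomial_term_large; lia.
Qed.

Lemma delannoy_trinomial n : delannoy n = 3 ^ n * sum_f_R0 (trinomial_term (INR n)) (n./2).
Proof.
suff [] : delannoy n = 3 ^ n * sum_f_R0 (trinomial_term (INR n)) (n./2) /\
  delannoy n.+1 = 3 ^ n.+1 * sum_f_R0 (trinomial_term (INR n.+1)) (n.+1./2) by [].
elim: n => [|n [IH0 IH1]]; first by rewrite /delannoy /=; split; field.
split=> //; have n0 := pos_INR n.
apply: (Rmult_eq_reg_l (INR n + 2)); last by lra.
rewrite delannoy_rec IH0 IH1.
have := trinomial_term_sum_rec (INR n.+1) n.+1.
have -> : INR n.+1 + 1 = INR n.+2 by rewrite !INRS.
have -> : INR n.+1 - 1 = INR n by rewrite INRS; ring.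
rewrite !trinomial_sum; try lia.
rewrite -!tech_pow_Rmult !INRS.
move: (sum_f_R0 _ _) (sum_f_R0 _ _) (sum_f_R0 _ _) => s0 s1 s2 e.
transitivity (9 * 3 ^ n * ((2 * (INR n + 1) + 1) * s1 - (INR n + 1) * s0 / 9)); first by field.
have -> : (2 * (INR n + 1) + 1) * s1 - (INR n + 1) * s0 / 9 = (INR n + 2) * s2 by lra.
by ring.
Qed.

(** Creative telescoping. The summand is that of the wanted formula minus those of [x s(x) / 2] and,
    by [trinomial_term_pred], of [x s(x - 1) / 6]. At integral [x] the right-hand side vanishes for
    a long enough sum, and scaling by [3^x] leaves [x (d x + d (x - 1)) / 2]. *)
Lemma trinomial_term_telescope x n :
  sum_f_R0 (fun k => trinomial_term x k *
     ((x - 2 * INR k) * (x + INR k + 2) / (INR k + 1) * (2 / 9) - x / 2 - (x - 2 * INR k) / 6)) n =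
  (INR n + 1) * trinomial_term x n.+1.
Proof.
elim: n => [|n IH]; first by rewrite /=; field.
have n0 := pos_INR n.
rewrite sum_f_R0_S IH [trinomial_term x n.+2]trinomial_termS.
by rewrite trinomial_termS !INRS; field; lra.
Qed.

Lemma ellGS_trinomial n : INR (ellGS n) =
  sum_f_R0 (fun k => INR 'C(n, k) * INR 'C(n - k, k)
                     * (INR (n - 2 * k) * INR (n + k + 2) / INR (k + 1))
                     * 2 ^ (k + 1)
                     * powerRZ 3 (Z.of_nat n - 2 * Z.of_nat k - 2)%Z)
           (n./2).
Proof.
rewrite (sum_eq _ (fun k => trinomial_term (INR n) k *
     ((INR n - 2 * INR k) * (INR n + INR k + 2) / (INR k + 1) * (2 / 9)) * 3 ^ n)); last first.
  move=> k /leP hk; have k0 := pos_INR k.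
  rewrite -trinomial_termE INR_subn ?INR_muln; last by lia.
  (* The exponent [n - 2k - 2] is -2 or -1 in the last term, so the splitting takes place among
     integer powers. *)
  have -> : 3 ^ n = powerRZ 3 (Z.of_nat n - 2 * Z.of_nat k - 2) * (9 * 9 ^ k).
    have -> : 9 * 9 ^ k = 3 ^ (2 * k + 2)%nat 
      by rewrite pow_add pow_mult /=; ring_simplify (3 * (3 * 1)); ring.
    rewrite !pow_powerRZ -powerRZ_add; last by lra.
    by congr powerRZ; lia.
  rewrite !INR_addn addn1 -tech_pow_Rmult /Rdiv Rpow_mult_distr pow_inv.
  rewrite [INR 1]/= [INR 2]/=; field; split; [lra|].
  by apply: pow_nonzero; lra.
case: n => [|n]; first by rewrite ellGS0 /=; field.
rewrite ellGS_delannoy -scal_sum.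
have := trinomial_term_telescope (INR n.+1) (n.+1./2).
rewrite trinomial_term_large ?Rmult_0_r; last by lia.
have e x m : sum_f_R0 (fun k => trinomial_term x k *
     ((x - 2 * INR k) * (x + INR k + 2) / (INR k + 1) * (2 / 9) - x / 2 - (x - 2 * INR k) / 6)) m =
   sum_f_R0 (fun k => trinomial_term x k *
     ((x - 2 * INR k) * (x + INR k + 2) / (INR k + 1) * (2 / 9))) m
   - x / 2 * sum_f_R0 (trinomial_term x) m - x / 6 * sum_f_R0 (trinomial_term (x - 1)) m.
  elim: m => [|m IH]; first by rewrite /=; field.
  rewrite !sum_f_R0_S IH.
  have -> : x / 6 * (sum_f_R0 (trinomial_term (x - 1)) m + trinomial_term (x - 1) m.+1) =
     x / 6 * sum_f_R0 (trinomial_term (x - 1)) m + x * trinomial_term (x - 1) m.+1 / 6 by field.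
  by have m0 := pos_INR m.+1; rewrite trinomial_term_pred; field; lra.
have x1 : INR n.+1 - 1 = INR n by rewrite INRS; ring.
rewrite e x1 !delannoy_trinomial.
rewrite (@trinomial_sum n (n.+1./2)); last by lia.
rewrite -tech_pow_Rmult -INRS.
move: (sum_f_R0 _ _) (sum_f_R0 _ _) (sum_f_R0 _ _) => s0 s1 s2 e2.
have -> : s2 = INR n.+1 / 2 * s1 + INR n.+1 / 6 * s0 by lra.
by field.
Qed.

(** * Generating functions *)

From Coquelicot Require Import Coquelicot.

Lemma R_plusE (x y : R) : plus x y = x + y.
Proof. by []. Qed.

Lemma R_scalE (x y : R) : scal x y = x * y.
Proof. by []. Qed.

Lemma R_zeroE : zero = 0.
Proof. by []. Qed.

Lemma CV_radius_geometric (a : nat -> R) K x : 0 < K -> (forall n, Rabs (a n) <= K ^ n) ->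
  Rabs x < / K -> Rbar_lt (Rabs x) (CV_radius a).
Proof.
move=> K0 ha hx; apply: (@Rbar_lt_le_trans _ (/ K)) => //.
have [ub _] := CV_radius_bounded a; apply: ub; exists 1 => n.
have Kn := pow_lt K n K0.
have iK : 0 < / K by apply: Rinv_0_lt_compat.
rewrite Rabs_mult -RPow_abs (Rabs_pos_eq (/ K)); last by lra.
rewrite pow_inv; apply: (Rmult_le_reg_r (K ^ n)) => //.
rewrite Rmult_assoc Rinv_l; last by lra.
by have := ha n; lra.
Qed.

Lemma is_derive_zero_const (f : R -> R) r : (forall x, Rabs x < r -> is_derive f x 0) ->
  forall x, Rabs x < r -> f x = f 0.
Proof.
move=> df x hx.
have hz z : Rmin 0 x <= z <= Rmax 0 x -> Rabs z < r.
  by move: hx; rewrite /Rmin /Rmax /Rabs; case: Rle_dec; case: Rcase_abs; case: Rcase_abs; lra.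
have [z hlt|z hle|c [_ e]] := @MVT_gen f 0 x (fun=> 0).
- by apply: df; apply: hz; lra.
- apply/continuity_pt_filterlim; apply: ex_derive_continuous; exists 0.
  exact: df (hz _ hle).
- by move: e; lra.
Qed.

(** The coefficient recurrence of [(1 - al x + be x^2)^(-1/2)]. *)
Definition inv_sqrt_rec (al be : R) (a : nat -> R) : Prop :=
  [/\ a 0%nat = 1, a 1%nat = al / 2 &
      forall n, (INR n + 2) * a n.+2 = al * (INR n + 3 / 2) * a n.+1 - be * (INR n + 1) * a n].

(** Comparison of coefficients: the two initial values settle the constant term, and the recurrence
    settles every other one. The geometric bound [K] only secures convergence. *)
Lemma inv_sqrt_ode al be K a x : inv_sqrt_rec al be a ->
  0 < K -> (forall n, Rabs (a n) <= K ^ n) -> Rabs x < / K ->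
  (1 - al * x + be * x ^ 2) * PSeries (PS_derive a) x = (al / 2 - be * x) * PSeries a x.
Proof.
move=> [a0 a1 arec] K0 aK hx; have hr := CV_radius_geometric K0 aK hx.
have pa := PSeries_correct _ _ (CV_radius_inside _ _ hr).
have pd := PSeries_correct _ _ (ex_pseries_derive _ _ hr).
move: (PSeries a x) (PSeries (PS_derive a) x) pa pd => F dF pa pd.
have comm (c : R) : mult x c = mult c x by exact: Rmult_comm.
have lhs := is_pseries_plus _ _ _ _ _ pd (is_pseries_plus _ _ _ _ _
  (is_pseries_scal (- al) _ _ _ (comm _) (is_pseries_incr_1 _ _ _ pd))
  (is_pseries_scal be _ _ _ (comm _) (is_pseries_incr_1 _ _ _ (is_pseries_incr_1 _ _ _ pd)))).
have rhs := is_pseries_plus _ _ _ _ _ (is_pseries_scal (al / 2) _ _ _ (comm _) pa)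
  (is_pseries_scal (- be) _ _ _ (comm _) (is_pseries_incr_1 _ _ _ pa)).
have -> : (1 - al * x + be * x ^ 2) * dF = dF + (- al * (x * dF) + be * (x * (x * dF))) by ring.
have -> : (al / 2 - be * x) * F = al / 2 * F + - be * (x * F) by ring.
etransitivity; first by symmetry; exact: (is_pseries_unique _ _ _ lhs).
etransitivity; last by exact: (is_pseries_unique _ _ _ rhs).
apply: PSeries_ext => n; rewrite /PS_plus /PS_scal /PS_derive /PS_incr_1.
rewrite !R_plusE !R_scalE; case: n => [|[|n]]; rewrite ?R_zeroE !INRS ?INR_0.
- by rewrite a0 a1; lra.
- by have := arec 0%nat; rewrite a0 INR_0; lra.
- by have := arec n.+1; rewrite INRS; lra.
Qed.

(** The differential equation makes the derivative of [F sqrt q] vanish throughout the interval, and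
    the product is [a 0 = 1] at the origin. *)
Lemma inv_sqrt_gf al be K a x : inv_sqrt_rec al be a ->
  0 < K -> (forall n, Rabs (a n) <= K ^ n) ->
  (forall z, Rabs z < / K -> 0 < 1 - al * z + be * z ^ 2) ->
  Rabs x < / K -> PSeries a x = / sqrt (1 - al * x + be * x ^ 2).
Proof.
move=> ha K0 aK q_gt0 hx; pose q z := 1 - al * z + be * z ^ 2.
have dF z : Rabs z < / K -> is_derive (fun y => PSeries a y * sqrt (q y)) z 0.
  move=> hz; have qz : 0 < q z := q_gt0 z hz; have sq := sqrt_lt_R0 _ qz.
  have dP := is_derive_PSeries _ _ (CV_radius_geometric K0 aK hz).
  have dq : is_derive q z (- al + 2 * be * z) by rewrite /q; auto_derive => //; ring.
  have dS := is_derive_sqrt _ _ _ dq qz.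
  have := is_derive_mult _ _ _ _ _ dP dS Rmult_comm.
  congr is_derive; rewrite /plus /mult /=.
  have ode : q z * PSeries (PS_derive a) z = (al / 2 - be * z) * PSeries a z.
    exact: inv_sqrt_ode ha K0 aK hz.
  apply: (Rmult_eq_reg_l (sqrt (q z))); last by lra.
  transitivity ((sqrt (q z) * sqrt (q z)) * PSeries (PS_derive a) z
                + PSeries a z * (- al + 2 * be * z) / 2); first by field; lra.
  by rewrite sqrt_sqrt ?ode; [field|lra].
have := is_derive_zero_const dF hx.
have q0 : q 0 = 1 by rewrite /q; ring.
rewrite q0 sqrt_1 PSeries_0; case: ha => -> _ _; rewrite Rmult_1_l => e.
have sq := sqrt_lt_R0 _ (q_gt0 x hx); rewrite -/(q x) in sq *.
by apply: (Rmult_eq_reg_r (sqrt (q x))); [rewrite e; field|]; lra.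
Qed.

(** Equal to [(1 + sqrt 2)^2]; its inverse is the root of [1 - 6x + x^2] nearest to the origin. *)
Definition rho : R := 3 + 2 * sqrt 2.

Lemma sqrt2_bounds : 1414 / 1000 < sqrt 2 < 1415 / 1000.
Proof.
have s0 := sqrt_pos 2; have s2 : sqrt 2 * sqrt 2 = 2 by apply: sqrt_sqrt; lra.
by split; nra.
Qed.

Lemma rhoV : / rho = 3 - 2 * sqrt 2.
Proof.
have s0 := sqrt2_bounds; have s2 : sqrt 2 * sqrt 2 = 2 by apply: sqrt_sqrt; lra.
apply: (Rmult_eq_reg_l rho); rewrite ?Rinv_r /rho; nra.
Qed.

(** Both bounds are carried together because the recurrence subtracts [d n]: monotonicity bounds
    [d n] above for the lower estimate, and [d n >= d (n + 1) / rho] gives the upper one through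
    [6 - 1 / rho = rho] and [3 <= rho]. *)
Lemma delannoy_step n : 0 < delannoy n /\ delannoy n <= delannoy n.+1 <= rho * delannoy n.
Proof.
have s0 := sqrt2_bounds; have s2 : sqrt 2 * sqrt 2 = 2 by apply: sqrt_sqrt; lra.
elim: n => [|n [IH0 [IH1 IH2]]]; first by rewrite /delannoy /rho /=; lra.
have n0 := pos_INR n; have e := delannoy_rec n.
have h : (3 - 2 * sqrt 2) * delannoy n.+1 <= delannoy n.
  apply: (Rle_trans _ ((3 - 2 * sqrt 2) * (rho * delannoy n))).
    by apply: Rmult_le_compat_l; lra.
  by rewrite -Rmult_assoc -rhoV Rinv_l ?Rmult_1_l; rewrite /rho; lra.
have d1 : 0 < delannoy n.+1 by lra.
split=> //; split; apply: (Rmult_le_reg_l (INR n + 2)); rewrite ?e; try lra.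
  have := Rmult_le_compat_l (INR n + 1) _ _ ltac:(lra) IH1.
  by have := Rmult_le_pos _ _ n0 (Rlt_le _ _ d1); lra.
have := Rmult_le_compat_l (INR n + 1) _ _ ltac:(lra) h.
have : 0 <= 2 * sqrt 2 * delannoy n.+1 by apply: Rmult_le_pos; lra.
by rewrite /rho; lra.
Qed.

Lemma delannoy_gt0 n : 0 < delannoy n.
Proof. by case: (delannoy_step n). Qed.

Lemma rho_gt0 : 0 < rho.
Proof. by have := sqrt2_bounds; rewrite /rho; lra. Qed.

Lemma delannoy_le_pow n : Rabs (delannoy n) <= rho ^ n.
Proof.
rewrite Rabs_pos_eq; last by have := delannoy_gt0 n; lra.
elim: n => [|n IH]; first by rewrite /delannoy /=; lra.
have [_ [_ h]] := delannoy_step n.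
by apply: (Rle_trans _ _ _ h); apply: Rmult_le_compat_l => //; have := rho_gt0; lra.
Qed.

Lemma delannoy_inv_sqrt_rec : inv_sqrt_rec 6 1 delannoy.
Proof.
split=> [||n]; try by rewrite /delannoy /=; lra.
by rewrite delannoy_rec; lra.
Qed.

Lemma delannoy_quadratic x : 1 - 6 * x + 1 * x ^ 2 = (1 - rho * x) * (1 - / rho * x).
Proof.
have s2 : sqrt 2 * sqrt 2 = 2 by apply: sqrt_sqrt; lra.
rewrite rhoV /rho.
transitivity (1 - 6 * x + (9 - 4 * (sqrt 2 * sqrt 2)) * x ^ 2); [rewrite s2|]; ring.
Qed.

Lemma delannoy_quadratic_gt0 x : Rabs x < / rho -> 0 < 1 - 6 * x + 1 * x ^ 2.
Proof.
move=> hx; rewrite delannoy_quadratic; have s0 := sqrt2_bounds.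
have [h1 h2] := Rabs_def2 _ _ hx.
have := Rmult_lt_compat_l _ _ _ rho_gt0 h1; rewrite Rinv_r; last by have := rho_gt0; lra.
rewrite rhoV in h1 h2 * => h.
by apply: Rmult_lt_0_compat; [lra|nra].
Qed.

Lemma delannoy_gf x : Rabs x < / rho -> PSeries delannoy x = / sqrt (1 - 6 * x + 1 * x ^ 2).
Proof.
exact: (inv_sqrt_gf delannoy_inv_sqrt_rec rho_gt0 delannoy_le_pow delannoy_quadratic_gt0).
Qed.

Lemma ellGS_gf x : Rabs x < 3 - 2 * sqrt 2 ->
  infinite_sum (fun n => INR (ellGS n) * x ^ n)
    (2 * (x - x ^ 2) / Rpower (1 - 6 * x + x ^ 2) (3 / 2)).
Proof.
rewrite -rhoV => hx.
have hr := CV_radius_geometric rho_gt0 delannoy_le_pow hx.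
have pa := PSeries_correct _ _ (CV_radius_inside _ _ hr).
have pd := PSeries_correct _ _ (ex_pseries_derive _ _ hr).
have q0 := delannoy_quadratic_gt0 hx; have sq := sqrt_lt_R0 _ q0.
have ode := inv_sqrt_ode delannoy_inv_sqrt_rec rho_gt0 delannoy_le_pow hx.
have gf := delannoy_gf hx.
have comm (c : R) : mult x c = mult c x by exact: Rmult_comm.
(* The coefficients of [x F'] are [n d n] and those of [x (F + x F')] are [n d (n - 1)]; half their
   sum is [ellGS n]. *)
have pl := is_pseries_scal (/ 2) _ _ _ (comm _) (is_pseries_plus _ _ _ _ _
  (is_pseries_incr_1 _ _ _ pd) (is_pseries_incr_1 _ _ _
     (is_pseries_plus _ _ _ _ _ pa (is_pseries_incr_1 _ _ _ pd)))).
apply/is_series_Reals/is_pseries_R.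
have -> : 2 * (x - x ^ 2) / Rpower (1 - 6 * x + x ^ 2) (3 / 2) =
   / 2 * (x * PSeries (PS_derive delannoy) x
          + x * (PSeries delannoy x + x * PSeries (PS_derive delannoy) x)).
  have -> : 1 - 6 * x + x ^ 2 = 1 - 6 * x + 1 * x ^ 2 by ring.
  move: ode; rewrite gf; set q := 1 - 6 * x + 1 * x ^ 2 in q0 sq *.
  move=> ode.
  have -> : PSeries (PS_derive delannoy) x = (3 - x) / (q * sqrt q).
    apply: (Rmult_eq_reg_l q); last by lra.
    by rewrite ode; field; lra.
  have -> : Rpower q (3 / 2) = q * sqrt q.
    have -> : 3 / 2 = 1 + / 2 by field.
    by rewrite Rpower_plus Rpower_1 // Rpower_sqrt.
  apply: (Rmult_eq_reg_l (q * sqrt q)); last by apply: Rmult_integral_contrapositive; lra.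
  transitivity (/ 2 * (x * (3 - x) + x * (q + x * (3 - x)))); last by field; lra.
  have -> : x * (3 - x) + x * (q + x * (3 - x)) = 4 * (x - x ^ 2) by rewrite /q; ring.
  by field; lra.
apply: is_pseries_ext pl => -[|n]; rewrite /PS_scal /PS_plus /PS_incr_1 /PS_derive.
  by rewrite ellGS0 R_scalE R_plusE !R_zeroE /=; ring.
rewrite ellGS_delannoy !R_scalE !R_plusE; case: n => [|n]; rewrite ?R_zeroE !INRS ?INR_0;
  by rewrite -[_ = _]/(@eq R _ _); field.
Qed.

(** * Asymptotics *)

(** ['C(2 * n, n) / 4 ^ n], the coefficients of [(1 - x)^(-1/2)]. *)
Fixpoint wallis (n : nat) : R :=
  match n with
  | 0%nat => 1
  | m.+1 => wallis m * (2 * INR m + 1) / (2 * INR m + 2)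
  end.

Lemma wallisS n : (2 * INR n + 2) * wallis n.+1 = (2 * INR n + 1) * wallis n.
Proof. by have n0 := pos_INR n; rewrite /=; field; lra. Qed.

Lemma wallis_gt0 n : 0 < wallis n.
Proof.
elim: n => [|n IH]; first by rewrite /=; lra.
have n0 := pos_INR n; rewrite /=; apply: Rdiv_lt_0_compat; last by lra.
by apply: Rmult_lt_0_compat; lra.
Qed.

Lemma wallis_decr n : wallis n.+1 <= wallis n.
Proof.
have n0 := pos_INR n; have w0 := wallis_gt0 n; have e := wallisS n.
by apply: (Rmult_le_reg_l (2 * INR n + 2)); lra.
Qed.

Lemma wallis_le1 n : wallis n <= 1.
Proof.
elim: n => [|n IH]; first by rewrite /=; lra.
exact: Rle_trans (wallis_decr n) IH.
Qed.

Lemma wallis_inv_sqrt_rec : inv_sqrt_rec 1 0 wallis.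
Proof.
split=> [||n]; [by []|by rewrite /=; field|].
by have := wallisS n.+1; rewrite INRS; lra.
Qed.

Lemma wallis_le_pow n : Rabs (wallis n) <= 1 ^ n.
Proof.
rewrite pow1 Rabs_pos_eq; first exact: wallis_le1.
by have := wallis_gt0 n; lra.
Qed.

Lemma wallis_gf x : Rabs x < 1 -> PSeries wallis x = / sqrt (1 - x).
Proof.
rewrite -{1}Rinv_1 => hx.
rewrite (inv_sqrt_gf wallis_inv_sqrt_rec Rlt_0_1 wallis_le_pow _ hx); first by congr (/ sqrt _); ring.
by move=> z; rewrite Rinv_1 => /Rabs_def2 [h1 h2]; lra.
Qed.

Lemma PSeries_scale_arg a c x : PSeries (fun k => a k * c ^ k) x = PSeries a (c * x).
Proof. by apply: Series_ext => k; rewrite Rpow_mult_distr Rmult_assoc. Qed.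

Lemma PSeries_inj a b r : 0 < r -> Rbar_lt 0 (CV_radius a) -> Rbar_lt 0 (CV_radius b) ->
  (forall x, Rabs x < r -> PSeries a x = PSeries b x) -> forall n, a n = b n.
Proof.
move=> r0 ra rb e n; apply: (Rmult_eq_reg_r (INR (fact n))); last exact: INR_fact_neq_0.
rewrite -!Derive_n_coef //; apply: Derive_n_ext_loc.
exists (mkposreal r r0) => t ht; apply: e.
by move: ht; rewrite /ball /= /AbsRing_ball /abs /minus /plus /opp /= Ropp_0 Rplus_0_r.
Qed.

Lemma sum_f_R0_bounds f n C : (forall k, (k <= n)%nat -> 0 <= f k <= C) ->
  0 <= sum_f_R0 f n <= C * INR n.+1.
Proof.
elim: n => [|n IH] h; first by have := h 0%nat (leqnn _); rewrite /=; lra.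
have := IH (fun k hk => h k (leqW hk)); have := h n.+1 (leqnn _).
by rewrite sum_f_R0_S [INR n.+2]INRS; lra.
Qed.

Lemma invrho_bounds : 0 < / rho < 173 / 1000.
Proof. by have := sqrt2_bounds; rewrite rhoV; lra. Qed.

(** Both sides are the coefficients of [1 / sqrt ((1 - rho x) (1 - x / rho))] near 0. *)
Lemma delannoy_convolution n : delannoy n =
  sum_f_R0 (fun k => wallis k * (/ rho) ^ k * (wallis (n - k) * rho ^ (n - k))) n.
Proof.
have rp := rho_gt0; have [ip i1] := invrho_bounds.
have rho1 : 1 <= rho by have := sqrt2_bounds; rewrite /rho; lra.
pose a k := wallis k * (/ rho) ^ k; pose b k := wallis k * rho ^ k.
have ha k : 0 <= a k <= 1.
  rewrite /a; have w0 := wallis_gt0 k; have w1 := wallis_le1 k.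
  have p0 := pow_lt (/ rho) k ip; have p1 : (/ rho) ^ k <= 1.
    by rewrite -(pow1 k); apply: pow_incr; lra.
  by split; [apply: Rmult_le_pos; lra|rewrite -(Rmult_1_r 1); apply: Rmult_le_compat; lra].
have hb k : 0 <= b k <= rho ^ k.
  rewrite /b; have w0 := wallis_gt0 k; have w1 := wallis_le1 k; have p0 := pow_lt rho k rp.
  split; first by apply: Rmult_le_pos; lra.
  by rewrite -[X in _ <= X]Rmult_1_l; apply: Rmult_le_compat; lra.
(* A crude bound suffices for a positive radius: there are [m + 1 <= 2^m] terms, each at most
   [rho^m]. *)
have hab m : Rabs (PS_mult a b m) <= (2 * rho) ^ m.
  have hk k : (k <= m)%nat -> 0 <= a k * b (m - k)%nat <= rho ^ m.
    move=> km; have [a0 a1] := ha k; have [b0 b1] := hb (m - k)%nat.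
    split; first exact: Rmult_le_pos.
    rewrite -[X in _ <= X]Rmult_1_l; apply: Rmult_le_compat => //.
    by apply: (Rle_trans _ _ _ b1); apply: Rle_pow => //; apply/leP; lia.
  have [s0 s1] := sum_f_R0_bounds hk.
  rewrite Rabs_pos_eq //; apply: (Rle_trans _ _ _ s1).
  rewrite Rpow_mult_distr Rmult_comm; apply: Rmult_le_compat_r; first by apply: pow_le; lra.
  elim: (m) => [|j IH]; first by rewrite /=; lra.
  rewrite -tech_pow_Rmult INRS; have := pos_INR j; move: IH; rewrite INRS; lra.
have rad c (K0 : 0 < c) (f : nat -> R) : (forall n, Rabs (f n) <= c ^ n) -> Rbar_lt 0 (CV_radius f).
  move=> hf; rewrite -Rabs_R0; apply: (CV_radius_geometric K0 hf).
  by rewrite Rabs_R0; apply: Rinv_0_lt_compat.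
have fa k : Rabs (a k) <= 1 ^ k by rewrite pow1 Rabs_pos_eq; case: (ha k).
have fb k : Rabs (b k) <= rho ^ k by rewrite Rabs_pos_eq; case: (hb k).
apply: (@PSeries_inj delannoy (PS_mult a b) (/ rho)) => //.
- exact: rad rp _ delannoy_le_pow.
- by apply: rad hab; lra.
move=> x hx; rewrite delannoy_gf // delannoy_quadratic.
have hx1 : Rabs x < / 1 by rewrite Rinv_1; lra.
rewrite PSeries_mult; last exact: CV_radius_geometric rp fb hx.
  rewrite !PSeries_scale_arg !wallis_gf.
  - rewrite sqrt_mult_alt; last first.
      have [h1 h2] := Rabs_def2 _ _ hx.
      have := Rmult_lt_compat_l _ _ _ rp h1; rewrite Rinv_r; lra.
    by rewrite Rinv_mult Rmult_comm.
  - rewrite Rabs_mult (Rabs_pos_eq rho); last by lra.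
    have := Rmult_lt_compat_l _ _ _ rp hx; rewrite Rinv_r; lra.
  - rewrite Rabs_mult (Rabs_pos_eq (/ rho)); last by lra.
    have := Rabs_pos x; nra.
exact: CV_radius_geometric Rlt_0_1 fa hx1.
Qed.

Lemma wallis_sub_ge n k : wallis n <= wallis (n - k).
Proof.
elim: k => [|k IH]; first by rewrite subn0; lra.
apply: (Rle_trans _ _ _ IH); rewrite subnS; case: (n - k)%nat => [|m] /=; first by lra.
exact: wallis_decr.
Qed.

(** The factor [4^k] is far from sharp, but it is absorbed by [rho^(-2k)] and is simple to
    propagate: if [q <= F] and [q <= 1], then [(1 + F)(1 + q) <= 1 + 4F]. *)
Lemma wallis_sub_le n k : (k <= n)%nat -> (0 < n)%nat ->
  wallis (n - k) <= wallis n * (1 + 4 ^ k / INR n).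
Proof.
move=> kn n0; have w0 := wallis_gt0 n.
have N0 : 1 <= INR n by apply: (le_INR 1); apply/leP.
elim: k kn => [|k IH] kn.
  rewrite subn0; have : 0 < wallis n * (1 / INR n); last by lra.
  by apply: Rmult_lt_0_compat => //; apply: Rdiv_lt_0_compat; lra.
have {}IH := IH (ltnW kn).
have e : (n - k = (n - k.+1).+1)%nat by lia.
have := wallisS (n - k.+1); rewrite -e.
have -> : INR (n - k.+1) = INR n - INR k - 1 by rewrite INR_subn // INRS; ring.
have k0 := pos_INR k; have kn' : INR k + 1 <= INR n by rewrite -INRS; apply/le_INR/leP.
have w1 := wallis_gt0 (n - k).
move=> e2.
have k4 : INR k + 1 <= 4 ^ k.
  elim: (k) => [|j IHj]; first by rewrite /=; lra.
  by rewrite -tech_pow_Rmult INRS; have := pos_INR j; lra.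
(* The exact ratio is [1 + 1 / (2(n - k) - 1)], and [n <= (k + 1)(2(n - k) - 1)] for [k < n]. *)
have step : wallis (n - k.+1) <= wallis (n - k) * (1 + (INR k + 1) / INR n).
  apply: (Rmult_le_reg_l (2 * (INR n - INR k - 1) + 1)); first by lra.
  rewrite -e2.
  have -> : (2 * (INR n - INR k - 1) + 1) * (wallis (n - k) * (1 + (INR k + 1) / INR n)) =
    (2 * (INR n - INR k - 1) + 2) * wallis (n - k) +
    wallis (n - k) * (((2 * (INR n - INR k - 1) + 1) * (INR k + 1) - INR n) / INR n) by field; lra.
  suff : 0 <= wallis (n - k) * (((2 * (INR n - INR k - 1) + 1) * (INR k + 1) - INR n) / INR n) by lra.
  apply: Rmult_le_pos; first by lra.
  by apply: Rdiv_le_0_compat; [nra|lra].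
apply: (Rle_trans _ _ _ step).
have q0 : 0 <= (INR k + 1) / INR n by apply: Rdiv_le_0_compat; lra.
have q1 : (INR k + 1) / INR n <= 1.
  by apply: (Rmult_le_reg_r (INR n)); rewrite ?Rmult_1_l /Rdiv ?Rmult_assoc ?Rinv_l; lra.
apply: (Rle_trans _ (wallis n * (1 + 4 ^ k / INR n) * (1 + (INR k + 1) / INR n))).
  by apply: Rmult_le_compat_r; lra.
rewrite Rmult_assoc; apply: Rmult_le_compat_l; first by lra.
have q2 : (INR k + 1) / INR n <= 4 ^ k / INR n.
  by apply: Rmult_le_compat_r; [apply/Rlt_le/Rinv_0_lt_compat; lra|].
rewrite -tech_pow_Rmult [4 * 4 ^ k / INR n]/Rdiv Rmult_assoc -/(4 ^ k / INR n).
by move: (4 ^ k / INR n) ((INR k + 1) / INR n) q0 q1 q2 => F q *; nra.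
Qed.

(** After division by [rho^n w n], the convolution term of index [k] is [w k rho^(-2k)] times a
    ratio between 1 and [1 + 4^k / n]. Since [4 rho^(-2) <= 1/2], the errors form a geometric sum
    bounded by [2 / n]. *)
Lemma delannoy_wallis_bounds n : (0 < n)%nat ->
  sum_f_R0 (fun k => wallis k * (/ rho * / rho) ^ k) n <= delannoy n / (rho ^ n * wallis n) <=
  sum_f_R0 (fun k => wallis k * (/ rho * / rho) ^ k) n + 2 / INR n.
Proof.
move=> n0; have rp := rho_gt0; have [ip i1] := invrho_bounds.
have w0 := wallis_gt0 n; have p0 := pow_lt rho n rp.
have N0 : 1 <= INR n by apply: (le_INR 1); apply/leP.
have c0 : 0 < rho ^ n * wallis n by apply: Rmult_lt_0_compat.
have term k : (k <= n)%nat -> exists2 X, 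
    wallis k * (/ rho) ^ k * (wallis (n - k) * rho ^ (n - k)) = rho ^ n * wallis n * X &
    wallis k * (/ rho * / rho) ^ k <= X <= wallis k * (/ rho * / rho) ^ k + (/ 2) ^ k / INR n.
  move=> kn; exists (wallis k * (/ rho * / rho) ^ k * (wallis (n - k) / wallis n)).
    have -> : rho ^ n = rho ^ (n - k) * rho ^ k by rewrite -pow_add; congr (_ ^ _); lia.
    have pk := pow_lt rho k rp.
    rewrite Rpow_mult_distr pow_inv; field; split; lra.
  have wk := wallis_gt0 k; have wk1 := wallis_le1 k.
  have r2 : 0 < / rho * / rho <= / 8 by split; nra.
  have x0 : 0 < (/ rho * / rho) ^ k by apply: pow_lt; lra.
  have y0 : 0 < wallis k * (/ rho * / rho) ^ k by apply: Rmult_lt_0_compat.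
  have h1 : 1 <= wallis (n - k) / wallis n.
    apply: (Rmult_le_reg_r (wallis n)) => //; rewrite Rmult_1_l /Rdiv Rmult_assoc Rinv_l; last by lra.
    by rewrite Rmult_1_r; apply: wallis_sub_ge.
  have h2 : wallis (n - k) / wallis n <= 1 + 4 ^ k / INR n.
    apply: (Rmult_le_reg_l (wallis n)) => //; rewrite /Rdiv Rmult_comm Rmult_assoc Rinv_l; last by lra.
    by rewrite Rmult_1_r; apply: wallis_sub_le.
  split; first by nra.
  apply: (Rle_trans _ (wallis k * (/ rho * / rho) ^ k * (1 + 4 ^ k / INR n))).
    by apply: Rmult_le_compat_l; lra.
  rewrite Rmult_plus_distr_l Rmult_1_r; apply: Rplus_le_compat_l.
  rewrite /Rdiv -Rmult_assoc; apply: Rmult_le_compat_r; first by apply/Rlt_le/Rinv_0_lt_compat; lra.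
  rewrite Rmult_assoc -Rpow_mult_distr -[X in _ <= X]Rmult_1_l.
  have z0 : 0 <= / rho * / rho * 4 <= / 2 by lra.
  apply: Rmult_le_compat; [lra|by apply: pow_le; lra|lra|by apply: pow_incr].
have geo m : sum_f_R0 (fun k => (/ 2) ^ k) m <= 2 - (/ 2) ^ m.
  by elim: m => [|m IH]; rewrite ?sum_f_R0_S -?tech_pow_Rmult /=; [|move: IH]; lra.
have part m : (m <= n)%nat -> exists2 X, 
    sum_f_R0 (fun k => wallis k * (/ rho) ^ k * (wallis (n - k) * rho ^ (n - k))) m
    = rho ^ n * wallis n * X &
    sum_f_R0 (fun k => wallis k * (/ rho * / rho) ^ k) m <= X <=
    sum_f_R0 (fun k => wallis k * (/ rho * / rho) ^ k) m + sum_f_R0 (fun k => (/ 2) ^ k) m / INR n.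
  elim: m => [|m IH] mn; first by have [X e h] := term 0%nat mn; exists X.
  have [X e h] := IH (ltnW mn); have [Y e' h'] := term m.+1 mn; exists (X + Y).
    by rewrite sum_f_R0_S e e'; ring.
  rewrite !sum_f_R0_S.
  have -> : (sum_f_R0 (fun k => (/ 2) ^ k) m + (/ 2) ^ m.+1) / INR n =
     sum_f_R0 (fun k => (/ 2) ^ k) m / INR n + (/ 2) ^ m.+1 / INR n by field; lra.
  by lra.
have [X e h] := part n (leqnn n).
rewrite delannoy_convolution e.
have -> : rho ^ n * wallis n * X / (rho ^ n * wallis n) = X by field; lra.
have g : sum_f_R0 (fun k => (/ 2) ^ k) n / INR n <= 2 / INR n.
  apply: Rmult_le_compat_r; first by apply/Rlt_le/Rinv_0_lt_compat; lra.
  by apply: (Rle_trans _ _ _ (geo n)); have := pow_lt (/ 2) n ltac:(lra); lra.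
by lra.
Qed.

Lemma is_lim_seq_inv_INR : is_lim_seq (fun n => / INR n.+1) 0.
Proof.
apply: (is_lim_seq_inv (fun n => INR n.+1) p_infty) => //.
by apply/(is_lim_seq_incr_1 INR p_infty); apply: is_lim_seq_INR.
Qed.

Lemma delannoy_wallis_lim :
  is_lim_seq (fun n => delannoy n.+1 / (rho ^ n.+1 * wallis n.+1)) (/ sqrt (1 - / rho * / rho)).
Proof.
have [ip i1] := invrho_bounds.
have r2 : Rabs (/ rho * / rho) < 1 by rewrite Rabs_pos_eq; nra.
have hs : is_lim_seq (fun n => sum_f_R0 (fun k => wallis k * (/ rho * / rho) ^ k) n.+1)
                     (/ sqrt (1 - / rho * / rho)).
  rewrite -(wallis_gf r2).
  apply/(is_lim_seq_incr_1 (sum_f_R0 (fun k => wallis k * (/ rho * / rho) ^ k))).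
  have hx : Rbar_lt (Rabs (/ rho * / rho)) (CV_radius wallis).
    by apply: (CV_radius_geometric Rlt_0_1 wallis_le_pow); rewrite Rinv_1.
  have /is_pseries_R h := PSeries_correct _ _ (CV_radius_inside _ _ hx).
  by apply: (is_lim_seq_ext (sum_n (fun k => wallis k * (/ rho * / rho) ^ k))) => [n|];
    [exact: sum_n_Reals|exact: h].
apply: (is_lim_seq_le_le _ _ _ _ _ hs).
  by move=> n; apply: delannoy_wallis_bounds.
rewrite -[X in is_lim_seq _ (Finite X)]Rplus_0_r -(Rmult_0_r 2).
apply: is_lim_seq_plus' => //; apply: is_lim_seq_mult'; first exact: is_lim_seq_const.
exact: is_lim_seq_inv_INR.
Qed.

(** * Wallis' product through the integrals of powers of sine *)

Definition sin_int (n : nat) : R := RInt (fun t => sin t ^ n) 0 (PI / 2).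

Lemma continuous_sin_pow n t : continuous (fun t => sin t ^ n) t.
Proof. by apply: ex_derive_continuous; auto_derive. Qed.

Lemma ex_RInt_sin_pow n : ex_RInt (fun t => sin t ^ n) 0 (PI / 2).
Proof. by apply: ex_RInt_continuous => t _; apply: continuous_sin_pow. Qed.

Lemma sin_int_rec n : (INR n + 2) * sin_int n.+2 = (INR n + 1) * sin_int n.
Proof.
(* Integration by parts in disguise: this primitive vanishes at both 0 and [PI / 2]. *)
have der t : is_derive (fun t => - cos t * sin t ^ n.+1) t
               (minus (scal (INR n + 2) (sin t ^ n.+2)) (scal (INR n + 1) (sin t ^ n))).
  auto_derive => //; rewrite -!/(INR n.+1) INRS.
  have e : cos t * cos t = 1 - sin t * sin t by have := sin2_cos2 t; rewrite /Rsqr; lra.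
  rewrite /minus /plus /opp /scal /= /mult /=.
  transitivity (sin t * (sin t * sin t ^ n) - (INR n + 1) * (cos t * cos t) * sin t ^ n); first by ring.
  by rewrite e; ring.
have cont t : continuous (fun t => minus (scal (INR n + 2) (sin t ^ n.+2)) (scal (INR n + 1) (sin t ^ n))) t.
  apply: continuous_minus; apply: continuous_scal_r; exact: continuous_sin_pow.
have h1 := is_RInt_derive _ _ 0 (PI / 2) (fun t _ => der t) (fun t _ => cont t).
have h2 : is_RInt (fun t => minus (scal (INR n + 2) (sin t ^ n.+2)) (scal (INR n + 1) (sin t ^ n)))
   0 (PI / 2) (minus (scal (INR n + 2) (sin_int n.+2)) (scal (INR n + 1) (sin_int n))).
  by apply: is_RInt_minus; apply: is_RInt_scal; apply: RInt_correct; apply: ex_RInt_sin_pow.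
have := is_RInt_unique _ _ _ _ h1; rewrite (is_RInt_unique _ _ _ _ h2).
rewrite cos_PI2 sin_0 /minus /plus /opp /scal /= /mult /=; lra.
Qed.

Lemma sin_int_decr n : sin_int n.+1 <= sin_int n.
Proof.
have p := PI_RGT_0.
apply: RInt_le => [|||t ht]; [lra|exact: ex_RInt_sin_pow|exact: ex_RInt_sin_pow|].
have s0 : 0 <= sin t by apply: sin_ge_0; lra.
have s1 := SIN_bound t.
by rewrite /=; have := pow_le (sin t) n s0; nra.
Qed.

Lemma sin_int_even n : sin_int (2 * n) = PI / 2 * wallis n.
Proof.
elim: n => [|n IH].
  rewrite muln0 /sin_int (RInt_ext _ (fun=> 1)) => [|t _ //].
  by rewrite RInt_const /scal /= /mult /=; ring.
have n0 := pos_INR n.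
apply: (Rmult_eq_reg_l (2 * INR n + 2)); last by lra.
have := sin_int_rec (2 * n); rewrite IH INR_muln [INR 2]/= mulnS add2n => ->.
transitivity (PI / 2 * ((2 * INR n + 1) * wallis n)); first by ring.
by rewrite -wallisS; ring.
Qed.

Lemma sin_int_odd n : (2 * INR n + 1) * wallis n * sin_int (2 * n).+1 = 1.
Proof.
elim: n => [|n IH].
  rewrite muln0 /sin_int (RInt_ext _ sin) => [|t _]; last by rewrite pow_1.
  have h := is_RInt_derive (fun t => - cos t) sin 0 (PI / 2).
  rewrite (is_RInt_unique _ _ _ _ (h _ _)) => [|t _|t _].
  - by rewrite cos_PI2 cos_0 /minus /plus /opp /=; ring.
  - by auto_derive => //; ring.
  - by apply: ex_derive_continuous; auto_derive.
have e : (2 * INR n + 1 + 2) * sin_int (2 * n).+3 = (2 * INR n + 1 + 1) * sin_int (2 * n).+1.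
  by have := sin_int_rec (2 * n).+1; rewrite INRS INR_muln.
rewrite mulnS add2n.
have -> : (2 * INR n.+1 + 1) * wallis n.+1 * sin_int (2 * n).+3 =
   wallis n.+1 * ((2 * INR n + 1 + 2) * sin_int (2 * n).+3) by rewrite INRS; ring.
rewrite e -[RHS]IH.
transitivity ((2 * INR n + 2) * wallis n.+1 * sin_int (2 * n).+1); first by ring.
by rewrite wallisS.
Qed.

(** Three consecutive sine integrals, of exponents [2n + 1], [2n + 2] and [2n + 3], decrease. The
    even one is [PI / 2] times [wallis (n + 1)], and the odd ones are reciprocals of multiples of
    [wallis], so each comparison bounds the square of [wallis (n + 1)]. *)
Lemma wallis_bounds n :
  1 - / INR n.+2 <= PI * INR n.+1 * (wallis n.+1 * wallis n.+1) <= 1.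
Proof.
have n0 := pos_INR n; have p := PI_RGT_0.
have w1 := wallis_gt0 n.+1; have w0 := wallis_gt0 n.
have e1 := sin_int_even n.+1; have o1 := sin_int_odd n.+1; have o0 := sin_int_odd n.
have d1 := sin_int_decr (2 * n.+1); have d0 := sin_int_decr (2 * n).+1.
have e2 : (2 * n).+2 = (2 * n.+1)%nat by lia.
rewrite e2 e1 in d0; rewrite e1 in d1; rewrite -wallisS in o0.
have i1 := INRS n; have i2 := INRS n.+1.
split.
  have h : 1 <= (2 * INR n.+1 + 1) * wallis n.+1 * (PI / 2 * wallis n.+1).
    by rewrite -[X in X <= _]o1; apply: Rmult_le_compat_l => //; apply: Rmult_le_pos; lra.
  move: h; have -> : (2 * INR n.+1 + 1) * wallis n.+1 * (PI / 2 * wallis n.+1) =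
    PI * INR n.+1 * (wallis n.+1 * wallis n.+1) * ((2 * INR n.+1 + 1) / (2 * INR n.+1)) by field; lra.
  set A := PI * _ * _ => h.
  apply: (Rmult_le_reg_r ((2 * INR n.+1 + 1) / (2 * INR n.+1))).
    by apply: Rdiv_lt_0_compat; lra.
  apply: (Rle_trans _ 1) => //.
  apply: (Rmult_le_reg_r (INR n.+2 * (2 * INR n.+1))); first by apply: Rmult_lt_0_compat; lra.
  rewrite i2 i1; have -> : (1 - / (INR n + 1 + 1)) * ((2 * (INR n + 1) + 1) / (2 * (INR n + 1))) *
    ((INR n + 1 + 1) * (2 * (INR n + 1))) = (INR n + 1) * (2 * (INR n + 1) + 1) by field; lra.
  by nra.
have h : (2 * INR n + 2) * wallis n.+1 * (PI / 2 * wallis n.+1) <= 1.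
  by rewrite -[X in _ <= X]o0; apply: Rmult_le_compat_l => //; apply: Rmult_le_pos; lra.
by move: h; rewrite i1; lra.
Qed.

Lemma wallis_lim : is_lim_seq (fun n => wallis n.+1 * sqrt (PI * INR n.+1)) 1.
Proof.
have p := PI_RGT_0.
have h : is_lim_seq (fun n => PI * INR n.+1 * (wallis n.+1 * wallis n.+1)) 1.
  apply: (is_lim_seq_le_le (fun n => 1 - / INR n.+2) _ (fun=> 1)) => [n||].
  - exact: wallis_bounds.
  - rewrite -[X in is_lim_seq _ (Finite X)]Rminus_0_r; apply: is_lim_seq_minus'.
      exact: is_lim_seq_const.
    by apply/(is_lim_seq_incr_1 (fun n => / INR n.+1)); apply: is_lim_seq_inv_INR.
  - exact: is_lim_seq_const.
rewrite -sqrt_1; apply: is_lim_seq_ext (is_lim_seq_continuous sqrt _ _ _ h) => [n|].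
  have w0 := wallis_gt0 n.+1; have n0 := pos_INR n.+1.
  rewrite sqrt_mult_alt; last by apply: Rmult_le_pos; lra.
  by rewrite sqrt_square; [ring|lra].
by apply: continuity_pt_sqrt; lra.
Qed.

Lemma delannoy_lim :
  is_lim_seq (fun n => delannoy n.+1 / rho ^ n.+1 * sqrt (PI * INR n.+1)) (/ sqrt (1 - / rho * / rho)).
Proof.
rewrite -[X in is_lim_seq _ (Finite X)]Rmult_1_r.
apply: is_lim_seq_ext (is_lim_seq_mult' _ _ _ _ delannoy_wallis_lim wallis_lim) => n.
have w0 := wallis_gt0 n.+1; have p0 := pow_lt rho n.+1 rho_gt0.
by field; lra.
Qed.

(** Consecutive terms of [delannoy_wallis_lim] are divided: the nonzero limit cancels, the [wallis]
    quotient tends to 1, and one factor [/ rho] remains. *)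
Lemma delannoy_ratio_lim : is_lim_seq (fun n => delannoy n / delannoy n.+1) (/ rho).
Proof.
have [ip i1] := invrho_bounds; have rp := rho_gt0.
apply/(is_lim_seq_incr_1 (fun n => delannoy n / delannoy n.+1)).
have s0 : 0 < sqrt (1 - / rho * / rho) by apply: sqrt_lt_R0; nra.
have l1 : is_lim_seq (fun n => wallis n.+1 / wallis n.+2) 1.
  apply: (is_lim_seq_le_le (fun=> 1) _ (fun n => 1 + / INR n.+1)) => [n||].
  - have w2 := wallis_gt0 n.+2; have e := wallisS n.+1; have n0 := pos_INR n; rewrite INRS in e *.
    have -> : wallis n.+1 / wallis n.+2 = 1 + / (2 * (INR n + 1) + 1).
      apply: (Rmult_eq_reg_r (wallis n.+2 * (2 * (INR n + 1) + 1))).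
        transitivity ((2 * (INR n + 1) + 1) * wallis n.+1); first by field; lra.
        by rewrite -e; field; lra.
      by apply: Rmult_integral_contrapositive; lra.
    have : 0 < / (2 * (INR n + 1) + 1) by apply: Rinv_0_lt_compat; lra.
    have : / (2 * (INR n + 1) + 1) <= / (INR n + 1) by apply: Rinv_le_contravar; lra.
    by lra.
  - exact: is_lim_seq_const.
  - rewrite -[X in is_lim_seq _ (Finite X)]Rplus_0_r.
    by apply: is_lim_seq_plus'; [exact: is_lim_seq_const|exact: is_lim_seq_inv_INR].
have l2 : is_lim_seq (fun n => delannoy n.+2 / (rho ^ n.+2 * wallis n.+2)) (/ sqrt (1 - / rho * / rho)).
  by apply/(is_lim_seq_incr_1 (fun n => delannoy n.+1 / (rho ^ n.+1 * wallis n.+1))); exact: delannoy_wallis_lim.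
have nz : / sqrt (1 - / rho * / rho) <> 0 by apply: Rinv_neq_0_compat; lra.
have := is_lim_seq_mult' _ _ _ _ (is_lim_seq_mult' _ _ _ _ (is_lim_seq_div' _ _ _ _ delannoy_wallis_lim l2 nz) l1)
  (is_lim_seq_const (/ rho)).
have -> : / sqrt (1 - / rho * / rho) / (/ sqrt (1 - / rho * / rho)) * 1 * / rho = / rho.
  by field; split; lra.
apply: is_lim_seq_ext => n.
have w1 := wallis_gt0 n.+1; have w2 := wallis_gt0 n.+2.
have p0 := pow_lt rho n.+1 rp; have d2 := delannoy_gt0 n.+2.
by rewrite -[rho ^ n.+2]tech_pow_Rmult; field; lra.
Qed.

Lemma ellGS_lim : Un_cv (fun n => INR (ellGS n) /
  (sqrt (INR n / (2 * sqrt 2 * PI)) * (1 + sqrt 2) ^ (2 * n))) 1.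
Proof.
have p := PI_RGT_0; have sb := sqrt2_bounds; have s2 : sqrt 2 * sqrt 2 = 2 by apply: sqrt_sqrt; lra.
have rp := rho_gt0; have [ip i1] := invrho_bounds.
apply/is_lim_seq_Reals/(is_lim_seq_incr_1 (fun n => INR (ellGS n) / _)).
have s0 : 0 < sqrt (1 - / rho * / rho) by apply: sqrt_lt_R0; nra.
have t0 : 0 < sqrt (2 * sqrt 2) by apply: sqrt_lt_R0; lra.
(* With [N = n + 1], [ellGS N] is [N d N (1 + d (N - 1) / d N) / 2]. The last constant converts
   [sqrt (PI N)] to the normalisation of the statement. *)
have := is_lim_seq_mult' _ _ _ _ delannoy_lim (is_lim_seq_mult' _ _ _ _
   (is_lim_seq_plus' _ _ _ _ (is_lim_seq_const 1) delannoy_ratio_lim)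
   (is_lim_seq_const (sqrt (2 * sqrt 2) / 2))).
have -> : / sqrt (1 - / rho * / rho) * ((1 + / rho) * (sqrt (2 * sqrt 2) / 2)) = 1.
  have e : (1 + / rho) * sqrt (2 * sqrt 2) = 2 * sqrt (1 - / rho * / rho).
    apply: Rsqr_inj; [apply: Rmult_le_pos; lra|apply: Rmult_le_pos; lra|].
    rewrite !Rsqr_mult !Rsqr_sqrt /Rsqr; [|nra|lra].
    rewrite rhoV; nra.
  transitivity (/ sqrt (1 - / rho * / rho) * ((1 + / rho) * sqrt (2 * sqrt 2)) / 2); first by field; lra.
  by rewrite e; field; lra.
apply: is_lim_seq_ext => n.
have n0 := pos_INR n; have N0 : 0 < INR n.+1 by rewrite INRS; lra.
have d0 := delannoy_gt0 n.+1; have p0 := pow_lt rho n.+1 rp.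
rewrite ellGS_delannoy -INRS pow_mult.
have -> : (1 + sqrt 2) ^ 2 = rho by rewrite /rho /=; nra.
have c0 : 0 < 2 * sqrt 2 * PI by apply: Rmult_lt_0_compat; lra.
have y0 : 0 < sqrt (INR n.+1 / (2 * sqrt 2 * PI)) by apply: sqrt_lt_R0; apply: Rdiv_lt_0_compat.
have e : sqrt (PI * INR n.+1) * sqrt (2 * sqrt 2) * sqrt (INR n.+1 / (2 * sqrt 2 * PI)) = INR n.+1.
  rewrite -!sqrt_mult_alt; try by apply: Rmult_le_pos; nra.
  rewrite -[RHS]sqrt_square; last by lra.
  by congr sqrt; field; lra.
rewrite -{2}e; field; lra.
Qed.

(** The quotient is [n (1 + d (n - 1) / d n) / 2], and [(1 + 1 / rho) / 2 = 2 - sqrt 2]. *)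
Lemma iGS_lim : Un_cv (fun n => iGS n / ((2 - sqrt 2) * INR n)) 1.
Proof.
have sb := sqrt2_bounds.
apply/is_lim_seq_Reals/(is_lim_seq_incr_1 (fun n => iGS n / _)).
have := is_lim_seq_mult' _ _ _ _
   (is_lim_seq_plus' _ _ _ _ (is_lim_seq_const 1) delannoy_ratio_lim)
   (is_lim_seq_const (/ (2 * (2 - sqrt 2)))).
have -> : (1 + / rho) * / (2 * (2 - sqrt 2)) = 1 by rewrite rhoV; field; lra.
apply: is_lim_seq_ext => n.
have n0 := pos_INR n; have N0 : 0 < INR n.+1 by rewrite INRS; lra.
have d0 := delannoy_gt0 n.+1.
rewrite /iGS /i_ratio -/(ellGS _) ellGS_delannoy size_GS -INRS.
by field; lra.
Qed.

Theorem mainTheorem15 :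
  (forall x : R, Rabs x < 3 - 2 * sqrt 2 ->
     infinite_sum (fun n => INR (ellGS n) * x ^ n)
       (2 * (x - x ^ 2) / Rpower (1 - 6 * x + x ^ 2) (3 / 2)))
  /\
  (forall n : nat,
     INR (ellGS n) =
     2 * sum_f_R0 (fun k => INR 'C(n + k, 2 * k) * INR 'C(2 * k, k) * INR (n - k)) n)
  /\
  (forall n : nat,
     INR (ellGS n) =
     sum_f_R0 (fun k => INR 'C(n, k) * INR 'C(n - k, k)
                        * (INR (n - 2 * k) * INR (n + k + 2) / INR (k + 1))
                        * 2 ^ (k + 1)
                        * powerRZ 3 (Z.of_nat n - 2 * Z.of_nat k - 2)%Z)
              (n./2))
  /\
  Un_cv (fun n => INR (ellGS n) /
                  (sqrt (INR n / (2 * sqrt 2 * PI)) * (1 + sqrt 2) ^ (2 * n))) 1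
  /\
  Un_cv (fun n => iGS n / ((2 - sqrt 2) * INR n)) 1.
Proof.
split; first exact: ellGS_gf.
split; first exact: ellGS_binomial.
split; first exact: ellGS_trinomial.
split; [exact: ellGS_lim|exact: iGS_lim].
Qed.
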